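(* Let $M$ and $N$ be smooth manifolds with $M$ compact. Then the $D$-topology on $C^\infty(M,N)$ coincides with the weak topology.
   Context: All smooth manifolds are Hausdorff, finite-dimensional, second countable and without boundary. $C^\infty(M,N)$ is the set of smooth maps from $M$ to $N$. It is equipped with the functional diffeology, whose plots are the maps $p:U\to C^\infty(M,N)$ ($U$ open in some $\mathbb{R}^n$, $n\in\mathbb{N}$) such that the map $U\times M\to N$, $(u,x)\mapsto p(u)(x)$, is smooth. The $D$-topology on $C^\infty(M,N)$ is the topology in which a set $A$ is open if and only if $p^{-1}(A)$ is open in $U$ for every plot $p:U\to C^\infty(M,N)$. The weak topology on $C^\infty(M,N)$ has as subbasis the sets $N^r(f,(U,\phi),(V,\psi),K,\epsilon)$, where $r\in\mathbb{N}$, $(U,\phi)$ is a chart of $M$, $(V,\psi)$ is a chart of $N$, $K\subseteq U$ is compact, $f\in C^\infty(M,N)$ satisfies $f(K)\subseteq V$, and $\epsilon>0$; this set consists of all $g\in C^\infty(M,N)$ such that $g(K)\subseteq V$ and $\|D^i(\psi\circ f\circ\phi^{-1})(x)-D^i(\psi\circ g\circ\phi^{-1})(x)\|<\epsilon$ for each $x\in\phi(K)$ and each multi-index $i\in\mathbb{N}^m$ ($m=\dim M$) with $|i|\le r$, where $|i|=i_1+\cdots+i_m$ and $D^i=\frac{\partial^{|i|}}{\partial x_1^{i_1}\cdots\partial x_m^{i_m}}$. *)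

(* Defs.v *)
From HB Require Import structures.
From mathcomp Require Import all_boot all_order all_algebra.
From mathcomp Require Import all_classical all_reals all_analysis.

Set Implicit Arguments.
Unset Strict Implicit.
Unset Printing Implicit Defensive.

Import Order.TTheory GRing.Theory Num.Theory.
Import numFieldNormedType.Exports.

Local Open Scope classical_set_scope.
Local Open Scope ring_scope.

Section euclidean_calculus.
Context {R : realType} {p q : nat}.
Implicit Types (f : 'rV[R]_p -> 'rV[R]_q) (s : seq 'I_p).

(* iter_partial [:: i1; ...; ir] f = d/dx_i1 (... (d/dx_ir f)) *)
Definition iter_partial s f : 'rV[R]_p -> 'rV[R]_q :=
  foldr (fun i g => 'D_(delta_mx 0 i) g) f s.

(* f is total, but for an open W this only depends on the restriction of f
   to W. *)
Definition smooth_on (W : set 'rV[R]_p) f :=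
  forall s x, W x ->
    {for x, continuous (iter_partial s f)} /\
    forall i : 'I_p, derivable (iter_partial s f) x (delta_mx 0 i).

Definition multi_index_order (a : 'I_p -> nat) := (\sum_(j < p) a j)%N.

(* d^|a| / dx_1^(a 1) ... dx_p^(a p) *)
Definition multi_partial (a : 'I_p -> nat) f : 'rV[R]_p -> 'rV[R]_q :=
  iter_partial (flatten [seq nseq (a j) j | j <- enum 'I_p]) f.

End euclidean_calculus.

(* A homeomorphism from an open subset of T to an open subset of R^m. Both
   directions are total functions, whose values are irrelevant outside of
   chart_dom, respectively of chart_fun @` chart_dom. *)
Record chart (R : realType) (T : topologicalType) (m : nat) := Chart {
  chart_dom : set T ;
  chart_fun :> T -> 'rV[R]_m ;
  chart_inv : 'rV[R]_m -> T ;
  chart_dom_open : open chart_dom ;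
  chart_codom_open : open (chart_fun @` chart_dom) ;
  chart_funK : forall x, chart_dom x -> chart_inv (chart_fun x) = x ;
  chart_fun_continuous :
    forall x, chart_dom x -> {for x, continuous chart_fun} ;
  chart_inv_continuous :
    forall y, (chart_fun @` chart_dom) y -> {for y, continuous chart_inv} }.

Arguments chart_dom {R T m}.
Arguments chart_inv {R T m}.

Definition chart_compatible (R : realType) (T : topologicalType) (m : nat)
    (c d : chart R T m) :=
  smooth_on (c @` (chart_dom c `&` chart_dom d)) (d \o chart_inv c) /\
  smooth_on (d @` (chart_dom c `&` chart_dom d)) (c \o chart_inv d).

Record manifold (R : realType) (m : nat) := Manifold {
  manifold_space :> topologicalType ;
  manifold_hausdorff : hausdorff_space manifold_space ;
  manifold_second_countable : @second_countable manifold_space ;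
  atlas : set (chart R manifold_space m) ;
  atlas_cover : forall x, exists2 c, atlas c & chart_dom c x ;
  atlas_compatible :
    forall c d, atlas c -> atlas d -> chart_compatible c d ;
  atlas_maximal :
    forall c, (forall d, atlas d -> chart_compatible c d) -> atlas c }.

Section euclidean_chart.
Context (R : realType) (k : nat).

Let fun_continuous (x : 'rV[R]_k) :
  [set: 'rV[R]_k] x -> {for x, continuous (@id 'rV[R]_k)}.
Proof. by move=> _; exact: cvg_id. Qed.

Let codom_open : open ((@id 'rV[R]_k) @` setT).
Proof. by rewrite image_id; exact: openT. Qed.

Definition euclidean_chart : chart R 'rV[R]_k k :=
  @Chart R _ k setT id id openT codom_open (fun _ _ => erefl)
    fun_continuous (fun y _ => fun_continuous (I : [set: _] y)).

End euclidean_chart.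

Section product_chart.
Context (R : realType) (S T : topologicalType) (p q : nat).
Variables (c : chart R S p) (d : chart R T q).

Let dom : set (S * T) := chart_dom c `*` chart_dom d.
Let fwd (z : S * T) : 'rV[R]_(p + q) := row_mx (c z.1) (d z.2).
Let inv (y : 'rV[R]_(p + q)) : S * T :=
  (chart_inv c (lsubmx y), chart_inv d (rsubmx y)).

Let lsubmx_continuous : continuous (@lsubmx R 1 p q).
Proof.
move=> y A [P Py PA]; pose Q i (j : 'I_(p + q)) := if fintype.split j is inl j' then P i j' else setT.
exists Q => [i j|z Qz].
  rewrite /Q; case: fintype.splitP => [j' jj'|j' _]; last exact: filterT.
  have := Py i j'; rewrite mxE.
  by suff -> : lshift q j' = j by []; apply: val_inj.
apply: PA => i j; have := Qz i (lshift q j); rewrite /Q mxE.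
by have /= -> := @unsplitK p q (inl j).
Qed.

Let rsubmx_continuous : continuous (@rsubmx R 1 p q).
Proof.
move=> y A [P Py PA]; pose Q i (j : 'I_(p + q)) := if fintype.split j is inr j' then P i j' else setT.
exists Q => [i j|z Qz].
  rewrite /Q; case: fintype.splitP => [j' _|j' jj']; first exact: filterT.
  have := Py i j'; rewrite mxE.
  by suff -> : rshift p j' = j by []; apply: val_inj.
apply: PA => i j; have := Qz i (rshift p j); rewrite /Q mxE.
by have /= -> := @unsplitK p q (inr j).
Qed.

Let dom_open : open dom.
Proof.
rewrite openE => z [cz dz]; exists (chart_dom c, chart_dom d) => //=.
by split; apply: open_nbhs_nbhs; split=> //; exact: chart_dom_open.
Qed.

Let codom_open : open (fwd @` dom).
Proof.
have -> : fwd @` dom = (@lsubmx R 1 p q @^-1` (c @` chart_dom c)) `&`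
                       (@rsubmx R 1 p q @^-1` (d @` chart_dom d)).
  apply/seteqP; split=> [_ [z [cz dz] <-]|y [[a ca ay] [b db yb]]].
    by split; rewrite /= /fwd ?row_mxKl ?row_mxKr; [exists z.1|exists z.2].
  by exists (a, b) => //; rewrite /fwd /= ay yb hsubmxK.
apply: openI; apply: open_comp; try exact: chart_codom_open.
  by move=> y _; exact: lsubmx_continuous.
by move=> y _; exact: rsubmx_continuous.
Qed.

Let funK z : dom z -> inv (fwd z) = z.
Proof.
case: z => a b [/= ca db].
by rewrite /inv /fwd row_mxKl row_mxKr !chart_funK.
Qed.

Let fun_continuous z : dom z -> {for z, continuous fwd}.
Proof.
move=> [/= cz dz] A [P Pz PA].
pose B := [set v : 'rV[R]_p | forall j, P 0 (lshift q j) (v 0 j)].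
pose C := [set v : 'rV[R]_q | forall j, P 0 (rshift p j) (v 0 j)].
have Pc : nbhs (c z.1) B.
  exists (fun _ j => P 0 (lshift q j)) => [i j|v Pv j]; last exact: Pv.
  by have := Pz 0 (lshift q j); rewrite /fwd row_mxEl ord1.
have Pd : nbhs (d z.2) C.
  exists (fun _ j => P 0 (rshift p j)) => [i j|v Pv j]; last exact: Pv.
  by have := Pz 0 (rshift p j); rewrite /fwd row_mxEr ord1.
exists (c @^-1` B, d @^-1` C).
  by split; [exact: chart_fun_continuous cz _ Pc
            |exact: chart_fun_continuous dz _ Pd].
move=> w [/= wc wd]; apply: PA => i j; rewrite ord1.
case: (fintype.splitP j) => j' jj'.
  have -> : j = lshift q j' by apply: val_inj.
  by rewrite /fwd row_mxEl; exact: wc.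
have -> : j = rshift p j' by apply: val_inj.
by rewrite /fwd row_mxEr; exact: wd.
Qed.

Let inv_continuous y : (fwd @` dom) y -> {for y, continuous inv}.
Proof.
move=> [z [cz dz] <-].
have ctsl : {for fwd z, continuous (chart_inv c \o @lsubmx R 1 p q)}.
  apply: continuous_comp; first exact: lsubmx_continuous.
  by apply: chart_inv_continuous; rewrite /fwd row_mxKl; exists z.1.
have ctsr : {for fwd z, continuous (chart_inv d \o @rsubmx R 1 p q)}.
  apply: continuous_comp; first exact: rsubmx_continuous.
  by apply: chart_inv_continuous; rewrite /fwd row_mxKr; exists z.2.
exact: (cvg_pair ctsl ctsr).
Qed.

Definition product_chart : chart R (S * T)%type (p + q) :=
  Chart dom_open codom_open funK fun_continuous inv_continuous.

End product_chart.

(* Smoothness, on the open set W, of f with respect to the smooth structures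
   given by the (not necessarily maximal) atlases A and B. *)
Definition smooth_in_charts (R : realType) (S T : topologicalType) (p q : nat)
    (A : set (chart R S p)) (B : set (chart R T q)) (W : set S) (f : S -> T) :=
  (forall x, W x -> {for x, continuous f}) /\
  forall a b, A a -> B b ->
    smooth_on (a @` (chart_dom a `&` W `&` f @^-1` chart_dom b))
      (b \o f \o chart_inv a).

Record smooth_map (R : realType) (m n : nat) (M : manifold R m)
    (N : manifold R n) := SmoothMap {
  smooth_map_fun :> M -> N ;
  smooth_mapP : smooth_in_charts (@atlas R m M) (@atlas R n N) setT
                  smooth_map_fun }.

HB.instance Definition _ (R : realType) (m n : nat) (M : manifold R m)
  (N : manifold R n) := gen_eqMixin (smooth_map M N).
HB.instance Definition _ (R : realType) (m n : nat) (M : manifold R m)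
  (N : manifold R n) := gen_choiceMixin (smooth_map M N).

Section mapping_space_topologies.
Context (R : realType) (m n : nat) (M : manifold R m) (N : manifold R n).

(* an atlas of the product manifold R^k x M *)
Definition euclidean_product_atlas (k : nat) :
    set (chart R ('rV[R]_k * M)%type (k + m)) :=
  [set product_chart (euclidean_chart R k) c | c in @atlas R m M].

(* The plots U -> smooth_map M N for U open in R^k, extended by arbitrary values
   outside of U; such an extension exists unless smooth_map M N is empty, in
   which case the only plot is the empty one. *)
Definition is_plot (k : nat) (U : set 'rV[R]_k)
    (p : 'rV[R]_k -> smooth_map M N) :=
  smooth_in_charts (@euclidean_product_atlas k) (@atlas R n N) (U `*` setT)
    (fun z => p z.1 z.2).

Definition D_open (A : set (smooth_map M N)) :=
  forall (k : nat) (U : set 'rV[R]_k) (p : 'rV[R]_k -> smooth_map M N),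
    open U -> is_plot U p -> open (U `&` p @^-1` A).

Lemma D_openT : D_open setT.
Proof. by move=> k U p oU _; rewrite preimage_setT setIT. Qed.

Lemma D_openI : setI_closed D_open.
Proof.
move=> A B oA oB k U p oU pU; rewrite preimage_setI setIIr.
by apply: openI; [exact: oA|exact: oB].
Qed.

Lemma D_open_bigU (I : Type) (F : I -> set (smooth_map M N)) :
  (forall i, D_open (F i)) -> D_open (\bigcup_i F i).
Proof.
move=> oF k U p oU pU; rewrite preimage_bigcup setI_bigcupr.
by apply: bigcup_open => i _; exact: oF.
Qed.

Definition D_smooth_map : Type := smooth_map M N.
HB.instance Definition _ := Choice.on D_smooth_map.
HB.instance Definition _ :=
  isOpenTopological.Build D_smooth_map D_openT D_openI D_open_bigU.

Definition smooth_map_D_topology : set (set (smooth_map M N)) :=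
  @open D_smooth_map.

(* N^r(f, (U, c), (V, d), K, e) with U := chart_dom c and V := chart_dom d *)
Definition weak_nbhd (r : nat) (f : smooth_map M N) (c : chart R M m)
    (d : chart R N n) (K : set M) (e : R) : set (smooth_map M N) :=
  [set g | g @` K `<=` chart_dom d /\
    forall x, (c @` K) x ->
    forall a : 'I_m -> nat, (multi_index_order a <= r)%N ->
      `| multi_partial a (d \o f \o chart_inv c) x
         - multi_partial a (d \o g \o chart_inv c) x | < e].

Definition weak_subbasis : set (set (smooth_map M N)) :=
  [set A | exists (r : nat) (f : smooth_map M N) (c : chart R M m)
      (d : chart R N n) (K : set M) (e : R),
    [/\ atlas c /\ atlas d, K `<=` chart_dom c /\ compact K,
        f @` K `<=` chart_dom d, 0 < e &
        A = weak_nbhd r f c d K e]].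

Definition weak_smooth_map : Type := smooth_map M N.
HB.instance Definition _ := Choice.on weak_smooth_map.
HB.instance Definition _ :=
  isSubBaseTopological.Build weak_smooth_map weak_subbasis id.

Definition smooth_map_weak_topology : set (set (smooth_map M N)) :=
  @open weak_smooth_map.

End mapping_space_topologies.

Arguments smooth_map_D_topology {R m n} M N.
Arguments smooth_map_weak_topology {R m n} M N.

(* Main.v *)
Require Import Defs.
From HB Require Import structures.
From mathcomp Require Import all_boot all_order all_algebra.
From mathcomp Require Import all_classical all_reals all_analysis.
From mathcomp Require Import finmap ring lra.

Set Implicit Arguments.
Unset Strict Implicit.
Unset Printing Implicit Defensive.

Import Order.TTheory GRing.Theory Num.Theory.
Import numFieldNormedType.Exports.

Local Open Scope classical_set_scope.
Local Open Scope ring_scope.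

(** Smoothness of plots makes the partial derivatives in the second variable
    jointly continuous, so by compactness weakly open sets are D-open.

    Conversely, if a D-open set [A] containing [f] is not a weak neighbourhood
    of [f], there are maps [g_k] outside of [A] converging to [f] as fast as
    one likes.  It suffices to build a smooth curve [F] of maps with [F 0 = f]
    and [F (2^-k) = g_k]: it is a plot, so [A] contains some [g_k], a
    contradiction.  In a pair of charts the curve is
    [f + sum_k psi_k(t) (g_k - f)], with bumps [psi_k] supported near
    [2^-k]; fast convergence makes all its derivatives vanish at [t = 0].
    These local curves are glued one chart of [M] at a time, without embedding
    [N]: a curve [F] is replaced inside a chart by
    [F + rho (local curve - F)], computed in the chart of [N]; this keeps the
    values [g_k] already reached and adds the points where the cutoff [rho]
    is [1]. *)

(** * Partial derivatives and smooth functions on Euclidean spaces *)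

(** Interpolating between two maps needs a linear structure, which [N] has only inside a chart, and
    the image of a chart need not be convex. This is why curves are handled as germs at t = 0: there
    every curve equals [f], which does lie in the chart, and compactness of a closed ball keeps it
    there for all times close to 0. Each gluing shortens the time domain, so finitely many gluings
    must suffice. Compactness of [M] provides this, and it also gathers the closeness conditions on
    [g_k] into a single weak neighbourhood of [f]. The speed of convergence depends on the bumps
    alone: [eps k] is computed from bounds on their derivatives of order at most k, before any chart
    or map is chosen. Letting k govern both the order and the accuracy loses nothing: for a fixed
    order only finitely many k escape control, and their bumps vanish near t = 0. Derivatives arise
    in the order dictated by inductions, while the weak topology records one fixed order, so
    symmetry of mixed derivatives enters both inclusions. *)

Section mean_value.
Context {R : realType} {V : normedModType R}.
Implicit Types (f : V -> R) (x v : V).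

Lemma is_derive_line f x v (t : R) : derivable f (t *: v + x) v ->
  is_derive t 1 (fun h : R => f (h *: v + x)) ('D_v f (t *: v + x)).
Proof.
move=> df.
have E : (fun h : R => h^-1 *: (((fun h : R => f (h *: v + x)) \o shift t) (h *: 1) -
           f (t *: v + x))) =
         (fun h : R => h^-1 *: ((f \o shift (t *: v + x)) (h *: v) - f (t *: v + x))).
  by apply/funext => h /=; rewrite [h *: 1]mulr1 scalerDl addrA.
by split; rewrite /derivable /derive E.
Qed.

Lemma MVT_line f x v (h : R) :
  (forall t : R, `|t| <= `|h| -> derivable f (t *: v + x) v) ->
  exists2 c : R, `|c| <= `|h| & f (h *: v + x) - f x = 'D_v f (c *: v + x) * h.
Proof.
move=> df; pose phi := fun t : R => f (t *: v + x).
have dphi (t : R) : `|t| <= `|h| -> is_derive t 1 phi ('D_v f (t *: v + x)).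
  by move=> /df; exact: is_derive_line.
have cphi (a b : R) : `|a| <= `|h| -> `|b| <= `|h| -> {within `[a, b], continuous phi}.
  move=> ah bh; apply: derivable_within_continuous => t; rewrite in_itv/= => /andP[at_ tb].
  have th : `|t| <= `|h|.
    by move: ah bh; rewrite !ler_norml => /andP[? ?] /andP[? ?]; apply/andP; split; lra.
  by case: (dphi _ th) => H _; exact: H.
have phi0 : phi 0 = f x by rewrite /phi scale0r add0r.
have n0 : `|0 : R| <= `|h| by rewrite normr0.
have [h0|h0] := leP 0 h.
  have [t|c] := @MVT_segment R phi (fun t => 'D_v f (t *: v + x)) 0 h h0 _ (cphi _ _ n0 (lexx _)).
    rewrite in_itv/= => /andP[t0 th]; apply: dphi.
    by rewrite (ger0_norm (ltW t0)) (ger0_norm h0) ltW.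
  rewrite in_itv/= => /andP[c0 ch]; rewrite phi0 subr0 => E; exists c => //.
  by rewrite (ger0_norm c0) (ger0_norm h0).
have [t|c] := @MVT_segment R phi (fun t => 'D_v f (t *: v + x)) h 0 (ltW h0) _
  (cphi _ _ (lexx _) n0).
  rewrite in_itv/= => /andP[t0 th]; apply: dphi.
  by rewrite !ler0_norm ?ltW// ltrN2.
rewrite in_itv/= => /andP[c0 ch]; rewrite phi0 sub0r => E; exists c.
  by rewrite (ler0_norm ch) (ler0_norm (ltW h0)) lerN2.
by rewrite -[LHS]opprK opprB E mulrN opprK.
Qed.

End mean_value.

Section derive_transport.
Context {R : realType} {V1 V2 W : normedModType R}.
Variables (f : V1 -> W) (g : V2 -> W) (x v : V1) (y w : V2).
Hypothesis fg : forall h : R, f (h *: v + x) = g (h *: w + y).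

Let quotients : (fun h : R => h^-1 *: ((f \o shift x) (h *: v) - f x)) =
                (fun h : R => h^-1 *: ((g \o shift y) (h *: w) - g y)).
Proof.
have := fg 0; rewrite !scale0r !add0r => fgx.
by apply/funext => h; rewrite /= fg fgx.
Qed.

(** A directional derivative depends only on the restriction to a line, so the two functions may
    live on different spaces; this serves translations as well as slices of a product. *)
Lemma derive_transport : 'D_v f x = 'D_w g y.
Proof. by rewrite /derive quotients. Qed.

Lemma derivable_transport : derivable f x v -> derivable g y w.
Proof. by rewrite /derivable quotients. Qed.

End derive_transport.

Lemma differentiable_approx (R : realType) (V W : normedModType R) (f : V -> W)
    (L : {linear V -> W}) (x : V) : continuous L ->
  (forall e : R, 0 < e -> \forall h \near 0, `|f (h + x) - f x - L h| <= e * `|h|) ->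
  differentiable f x.
Proof.
move=> cL fL.
have fo : f \o shift x = cst (f x) + L +o_ 0 id.
  apply/eqaddoP => e e0; have := fL e e0; apply: filterS => h.
  by rewrite [X in _ -> X]/= opprD addrA.
have dL : 'd f x = L :> (_ -> _) by apply: diff_unique.
by apply/diff_locallyP; rewrite dL.
Qed.

Section partial_derivatives.
Context {R : realType} {p : nat}.
Implicit Types (f g : 'rV[R]_p -> R) (s : seq 'I_p) (x y : 'rV[R]_p).
Implicit Types W : set 'rV[R]_p.

Local Notation e_ i := (delta_mx 0 i : 'rV[R]_p).

Lemma norm_coord_le x i : `|x 0 i| <= `|x|.
Proof.
by rewrite [leRHS]/Num.Def.normr/= mx_normrE; exact: (le_bigmax _ _ (ord0, i)).
Qed.

Lemma norm_row_le x (e : R) : 0 <= e -> (forall i, `|x 0 i| <= e) -> `|x| <= e.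
Proof.
move=> e0 xe; rewrite [leLHS]/Num.Def.normr/= mx_normrE.
by apply/bigmax_le => // -[i j] _ /=; rewrite ord1.
Qed.

Lemma norm_row_lt x (e : R) : 0 < e -> (forall i, `|x 0 i| < e) -> `|x| < e.
Proof.
move=> e0 xe; rewrite [ltLHS]/Num.Def.normr/= mx_normrE.
by apply/bigmax_lt => // -[i j] _ /=; rewrite ord1.
Qed.

Lemma norm_delta_le i : `|e_ i| <= 1.
Proof.
apply: norm_row_le => // j; rewrite mxE eqxx /=.
by case: (j == i); rewrite ?normr1 ?normr0.
Qed.

Definition partials s f : 'rV[R]_p -> R :=
  foldr (fun i g => 'D_(e_ i) g) f s.

Lemma partials_cons i s f : partials (i :: s) f = 'D_(e_ i) (partials s f).
Proof. by []. Qed.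

Lemma partials_cat s1 s2 f : partials (s1 ++ s2) f = partials s1 (partials s2 f).
Proof. by rewrite /partials foldr_cat. Qed.

Lemma partials_rcons s i f : partials (rcons s i) f = partials s ('D_(e_ i) f).
Proof. by rewrite -cats1 partials_cat. Qed.

Let prefix_row (h : 'rV[R]_p) (k : nat) : 'rV[R]_p :=
  \row_i (if (i < k)%N then h 0 i else 0).

Let prefix_rowS h k (kp : (k < p)%N) :
  prefix_row h k.+1 = h 0 (Ordinal kp) *: e_ (Ordinal kp) + prefix_row h k.
Proof.
apply/rowP => i; rewrite !mxE eqxx/=.
have [ki|ik|ki] := ltngtP k i; rewrite ?ltnS.
- by rewrite leqNgt ki /= -val_eqE /= gtn_eqF// mulr0 addr0.
- by rewrite (ltnW ik) -val_eqE /= ltn_eqF// mulr0 add0r.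
- have -> : Ordinal kp = i by apply: val_inj.
  by rewrite ki leqnn eqxx mulr1 addr0.
Qed.

(* Moving from x to x + h one coordinate at a time, each step stays in the sup
   norm ball of radius |h| and is controlled by the mean value theorem. *)
Lemma differentiable_partials f x :
  (forall i : 'I_p, \forall y \near x, derivable f y (e_ i)) ->
  (forall i : 'I_p, {for x, continuous ('D_(e_ i) f)}) -> differentiable f x.
Proof.
move=> df cf.
pose L (h : 'rV[R]_p) : R := \sum_i 'D_(e_ i) f x * h 0 i.
have linL : linear L.
  move=> a u v; rewrite /L -[a *: (\sum_(i < p) _)]/(a * _) mulr_sumr.
  rewrite -big_split/=; apply: eq_bigr => i _.
  by rewrite !mxE mulrDr mulrCA.
pose LM := GRing.isLinear.Build _ _ _ _ _ linL.
pose LL : {linear 'rV[R]_p -> R} := HB.pack L LM.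
have cL : continuous LL.
  move=> y; apply: (@differentiable_continuous _ _ _ y LL).
  have := @differentiable_sum R 'rV[R]_p R p (fun i h => 'D_(e_ i) f x * h 0 i) y.
  rewrite fct_sumE; apply => i.
  by apply: (@differentiableZ _ _ _ (fun h : 'rV[R]_p => h 0 i)); exact: differentiable_coord.
apply: (differentiable_approx cL) => _/posnumP[e].
  (* Each of the [p] coordinate steps costs [e' * |h|]; dividing by [p.+1] keeps the total below
     [e * |h|] and makes sense for [p = 0]. *)
  pose e' := e%:num / p.+1%:R.
  have e'0 : 0 < e' by rewrite divr_gt0.
  have : \forall y \near x, forall i : 'I_p, derivable f y (e_ i) /\
      `|'D_(e_ i) f y - 'D_(e_ i) f x| <= e'.
    pose P (i : 'I_p) y := derivable f y (e_ i) /\ `|'D_(e_ i) f y - 'D_(e_ i) f x| <= e'.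
    apply: (@filter_forall _ _ P (nbhs x) _) => i; apply: filterI; first exact: df.
    have /cvgrPdist_le/(_ _ e'0) := cf i.
    by apply: filterS => y; rewrite distrC.
  move=> /nbhs_ballP[d /= d0 dP]; apply/nbhs_ballP; exists d => // h.
rewrite -ball_normE /ball_/= sub0r normrN => hd.
  have key k : (k <= p)%N ->
    `|f (prefix_row h k + x) - f x - \sum_(i < p | (i < k)%N) 'D_(e_ i) f x * h 0 i|
      <= k%:R * e' * `|h|.
    elim: k => [_|k IH kp].
      rewrite big_pred0 // subr0 !mul0r.
      have -> : prefix_row h 0 = 0 by apply/rowP => i; rewrite !mxE.
      by rewrite add0r subrr normr0.
    have := IH (ltnW kp); set o := Ordinal kp.
    have [|c ch] := @MVT_line _ _ f (prefix_row h k + x) (e_ o) (h 0 o).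
      move=> t th; apply: (dP _ _ o).1.
      rewrite -ball_normE /ball_/= distrC addrA addrK.
      apply: le_lt_trans hd; apply: norm_row_le => // i; rewrite !mxE eqxx/=.
      case: (eqVneq i o) => [->|io]; last first.
        by rewrite mulr0 add0r; case: ifP; rewrite ?norm_coord_le ?normr0.
      by rewrite ltnn addr0 mulr1 (le_trans th)// norm_coord_le.
    rewrite addrA -prefix_rowS => E.
    have cc : `|'D_(e_ o) f (c *: e_ o + (prefix_row h k + x)) - 'D_(e_ o) f x| <= e'.
      apply: (dP _ _ o).2.
      rewrite -ball_normE /ball_/= distrC addrA addrK.
      apply: le_lt_trans hd; apply: norm_row_le => // i; rewrite !mxE eqxx/=.
      case: (eqVneq i o) => [->|io]; last first.
        by rewrite mulr0 add0r; case: ifP; rewrite ?norm_coord_le ?normr0.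
      by rewrite ltnn addr0 mulr1 (le_trans ch)// norm_coord_le.
    have -> : \sum_(i < p | (i < k.+1)%N) 'D_(e_ i) f x * h 0 i =
       'D_(e_ o) f x * h 0 o + \sum_(i < p | (i < k)%N) 'D_(e_ i) f x * h 0 i.
      rewrite (bigD1 o)/=; last by [].
      congr (_ + _); apply: eq_bigl => i.
      by rewrite ltnS -val_eqE/= ltn_neqAle andbC.
    move=> IHk.
    set D := 'D_(e_ o) f (c *: e_ o + (prefix_row h k + x)) in E cc.
    set F := f (prefix_row h k.+1 + x) in E *; set S := \sum_(i < p | _) _ in IHk *.
    have -> : F - f x - ('D_(e_ o) f x * h 0 o + S) =
        (f (prefix_row h k + x) - f x - S) + (D - 'D_(e_ o) f x) * h 0 o.
      by rewrite mulrBl -E; ring.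
    rewrite -[k.+1]addn1 natrD [_ * e']mulrDl mul1r [X in _ <= X]mulrDl.
    rewrite (le_trans (ler_normD _ _))// lerD//.
    by rewrite normrM ler_pM// norm_coord_le.
  have := key p (leqnn _).
  have -> : prefix_row h p = h by apply/rowP => i; rewrite mxE ltn_ord.
  rewrite (eq_bigl predT) => [|i]; last by rewrite ltn_ord.
  move=> H; apply: le_trans H _.
  rewrite ler_wpM2r// /e' mulrCA ler_piMr// ler_pdivrMr ?mul1r ?ler_nat//.
Qed.



(** The second difference is the increment in direction i of an increment in direction j, so the
    mean value theorem applies twice. It is symmetric in [i] and [j] while the resulting derivative
    is not, which is what [partials_swap] exploits. *)
Lemma MVT_second f x i j (h : R) W :
  (forall a b : R, `|a| <= `|h| -> `|b| <= `|h| -> W (a *: e_ i + b *: e_ j + x)) ->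
  (forall y, W y -> differentiable f y) ->
  (forall y, W y -> differentiable ('D_(e_ i) f) y) ->
  exists a b : R, [/\ `|a| <= `|h|, `|b| <= `|h| &
    f (h *: e_ i + h *: e_ j + x) - f (h *: e_ i + x) - f (h *: e_ j + x) + f x =
    'D_(e_ j) ('D_(e_ i) f) (a *: e_ i + b *: e_ j + x) * h * h].
Proof.
move=> hW df ddf.
have n0 : `|0 : R| <= `|h| by rewrite normr0.
have W0 t : `|t| <= `|h| -> W (t *: e_ i + x).
  by move=> th; have := hW t 0 th n0; rewrite scale0r addr0.
pose u y := f (y + h *: e_ j) - f y.
have du t : `|t| <= `|h| -> is_derive (t *: e_ i + x) (e_ i) u
      ('D_(e_ i) f (t *: e_ i + h *: e_ j + x) - 'D_(e_ i) f (t *: e_ i + x)).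
  move=> th; apply: is_deriveB; last first.
    by apply: derivableP; apply/diff_derivable/df/W0.
  have E (k : R) : f (k *: e_ i + (t *: e_ i + h *: e_ j + x)) =
             f (k *: e_ i + (t *: e_ i + x) + h *: e_ j).
    by congr f; rewrite -!addrA; congr (_ + (_ + _)); rewrite addrC.
  rewrite (derive_transport (g := fun y => f (y + h *: e_ j)) E); apply: derivableP.
  by apply: (derivable_transport (f := f) E); apply/diff_derivable/df/hW.
have [t th|a ah] := @MVT_line _ _ u x (e_ i) h.
  by have [? _] := du _ th.
have [_ ->] := du _ ah => Ea.
have [t th|b bh] := @MVT_line _ _ ('D_(e_ i) f) (a *: e_ i + x) (e_ j) h.
  by rewrite addrCA addrA; apply/diff_derivable/ddf/hW.
rewrite !(addrCA _ (a *: e_ i)) !addrA => Eb.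
exists a, b; split => //; rewrite -Eb -Ea /u [h *: e_ j + x]addrC (addrAC (h *: e_ i)).
by ring.
Qed.

(** Fréchet differentiability of all iterated partials is the form of smoothness that passes through
    products and composites; [smooth_onP] identifies it with [smooth_on] on open sets. *)
Definition smooth_real W f := forall s x, W x -> differentiable (partials s f) x.

Lemma smooth_real_differentiable W f x : smooth_real W f -> W x -> differentiable f x.
Proof. by move=> fW; exact: (fW [::]). Qed.

Lemma smooth_real_continuous W f x : smooth_real W f -> W x -> {for x, continuous f}.
Proof. by move=> fW /(smooth_real_differentiable fW); exact: differentiable_continuous. Qed.

Lemma smooth_real_partials W f s : smooth_real W f -> smooth_real W (partials s f).
Proof. by move=> fW t x Wx; rewrite -partials_cat; exact: fW. Qed.

Lemma smooth_real_subset W W' f : W `<=` W' -> smooth_real W' f -> smooth_real W f.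
Proof. by move=> WW' fW s x /WW'; exact: fW. Qed.

Lemma eq_at_limit (A B : 'rV[R]_p -> R) x :
  {for x, continuous A} -> {for x, continuous B} ->
  (forall d : R, 0 < d -> exists y z, [/\ ball x d y, ball x d z & A y = B z]) ->
  A x = B x.
Proof.
move=> /cvgrPdist_le cA /cvgrPdist_le cB AB; apply/eqP; rewrite -subr_eq0 -normr_le0.
apply/ler_addgt0Pr => e e0; rewrite add0r.
have e20 : 0 < e / 2 by rewrite divr_gt0.
have /nbhs_ballP[d /= d0 dP] : nbhs x (fun y => `|A x - A y| <= e / 2 /\ `|B x - B y| <= e / 2).
  exact: filterI (cA _ e20) (cB _ e20).
have [y [z [/dP[Ay _] /dP[_ Bz] E]]] := AB d d0.
rewrite -(subrKA (A y)) (le_trans (ler_normD _ _))// (splitr e) lerD//.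
by rewrite E distrC.
Qed.

(** By [MVT_second] one second difference at scale [h] is [h * h] times either mixed derivative,
    each at some point near [x]. Both are continuous, so they agree at [x] itself. *)
Lemma partials_swap W f i j x : open W -> smooth_real W f -> W x ->
  'D_(e_ i) ('D_(e_ j) f) x = 'D_(e_ j) ('D_(e_ i) f) x.
Proof.
move=> oW fW Wx.
apply: (@eq_at_limit ('D_(e_ i) ('D_(e_ j) f)) ('D_(e_ j) ('D_(e_ i) f))).
- exact: (smooth_real_continuous (@smooth_real_partials W f [:: i; j] fW)).
- exact: (smooth_real_continuous (@smooth_real_partials W f [:: j; i] fW)).
move=> d' d'0.
have /nbhs_ballP[d /= d0 dP] : nbhs x (W `&` ball x d').
  by apply: filterI; [exact: open_nbhs_nbhs|exact: nbhsx_ballx].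
(* Two displacements of norm at most [h] stay within [d / 2], hence in the ball. *)
pose h := d / 4.
have h0 : 0 < h by rewrite divr_gt0.
have hd (a b : R) k l : `|a| <= `|h| -> `|b| <= `|h| ->
    (W `&` ball x d') (a *: e_ k + b *: e_ l + x).
  move=> ah bh; apply: dP; rewrite -ball_normE /ball_/= distrC addrK.
  have hh : `|h| + `|h| < d by rewrite gtr0_norm// /h; lra.
  apply: le_lt_trans hh; rewrite (le_trans (ler_normD _ _))// lerD// normrZ.
    by rewrite (le_trans _ ah)// ler_piMr// norm_delta_le.
  by rewrite (le_trans _ bh)// ler_piMr// norm_delta_le.
have df y : W y -> differentiable f y by exact: (fW [::]).
have ddf k y : W y -> differentiable ('D_(e_ k) f) y by exact: (fW [:: k]).
have hW k l (a b : R) : `|a| <= `|h| -> `|b| <= `|h| -> W (a *: e_ k + b *: e_ l + x).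
  by move=> ah bh; exact: (hd _ _ _ _ ah bh).1.
have [a [b [ah bh E1]]] := MVT_second (hW i j) df (ddf i).
have [a' [b' [ah' bh' E2]]] := MVT_second (hW j i) df (ddf j).
exists (a' *: e_ j + b' *: e_ i + x), (a *: e_ i + b *: e_ j + x).
split; [exact: (hd _ _ _ _ ah' bh').2|exact: (hd _ _ _ _ ah bh).2|].
apply: (mulIf (lt0r_neq0 h0)); apply: (mulIf (lt0r_neq0 h0)).
apply: etrans (esym E2) (etrans _ E1); rewrite (addrC (h *: e_ j) (h *: e_ i)).
by rewrite (addrAC _ (- f (h *: e_ j + x))).
Qed.

Lemma partials_eq W f g s x : open W -> (forall y, W y -> f y = g y) -> W x ->
  partials s f x = partials s g x.
Proof.
move=> oW fg; elim: s x => [|i s IH] x Wx; first exact: fg.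
apply: near_eq_derive; have := open_nbhs_nbhs (conj oW Wx).
by apply: filterS => y; exact: IH.
Qed.

(** Adjacent swaps bring the head of [s] to the front of [t]. This is what lets arbitrary lists of
    directions be compared with the fixed order of [multi_partial]. *)
Lemma partials_perm W f s t x : open W -> smooth_real W f -> perm_eq s t -> W x ->
  partials s f x = partials t f x.
Proof.
move=> oW fW; elim: s t x => [|i s IH] t x st Wx.
  by have := perm_size st; case: t st.
have /splitPr : i \in t by rewrite -(perm_mem st) mem_head.
move=> H; case: H st => t1 t2 st.
have {}st : perm_eq s (t1 ++ t2).
  by rewrite -(perm_cons i) (perm_trans st)// perm_catC/= perm_cons perm_catC.
have -> : partials (i :: s) f x = partials (i :: t1 ++ t2) f x.
  by apply: (@partials_eq W _ _ [:: i]) => // y Wy; exact: IH.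
elim: t1 x Wx {st} => [//|j t1 IH1] x Wx /=.
rewrite (partials_swap i j oW (@smooth_real_partials W f (t1 ++ t2) fW) Wx).
by apply: (@partials_eq W _ _ [:: j]) => // y Wy; exact: IH1.
Qed.

End partial_derivatives.

Lemma differentiable_eq_near (R : realType) (V W : normedModType R) (f g : V -> W) (x : V) :
  (\forall y \near x, f y = g y) -> differentiable f x -> differentiable g x.
Proof.
move=> fg df; apply: (differentiable_approx (L := 'd f x)) => [|e e0].
  exact: diff_continuous.
have fgx : f x = g x by exact: nbhs_singleton fg.
have fg0 : \forall h \near 0, f (h + x) = g (h + x).
  have := fg; rewrite (near_shift 0 x) /=.
  by apply: filterS => h; rewrite subr0.
have := diff_locally df => /eqaddoP/(_ e e0) fo.
apply: filterS (filterI fg0 fo) => h [/= <-].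
by rewrite -fgx [X in X -> _]/= opprD addrA.
Qed.

(** * Stability of smooth real functions under algebraic operations *)

Section smooth_closure.
Context {R : realType} {p : nat}.
Implicit Types (f g : 'rV[R]_p -> R) (s : seq 'I_p) (x y : 'rV[R]_p).
Implicit Types W : set 'rV[R]_p.
Local Notation e_ i := (delta_mx 0 i : 'rV[R]_p).

(** A finite order gives something to induct on: the Leibniz and chain rules express the derivatives
    at order n + 1 through functions known to order n. *)
Definition differentiable_upto n W f :=
  forall s x, (size s <= n)%N -> W x -> differentiable (partials s f) x.

Lemma smooth_real_upto W f : smooth_real W f <-> forall n, differentiable_upto n W f.
Proof. by split=> [fW n s x _|fW s]; [exact: fW|move=> x; exact: (fW (size s))]. Qed.

(** The innermost derivative is peeled off, not the outermost: the induction hypothesis is then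
    applied to the function ['D_(e_ i) f], whose formula is known. *)
Lemma differentiable_uptoS n W f : differentiable_upto n.+1 W f <->
  (forall x, W x -> differentiable f x) /\
  forall i, differentiable_upto n W ('D_(e_ i) f).
Proof.
split=> [fW|[f0 fS] s x].
  split=> [x|i s x sn]; first exact: (fW [::]).
  by rewrite -partials_rcons; apply: fW; rewrite size_rcons.
case: (lastP s) => [_|t i]; first exact: f0.
by rewrite size_rcons ltnS partials_rcons => tn; exact: fS.
Qed.

Lemma differentiable_uptoW n W f : differentiable_upto n.+1 W f -> differentiable_upto n W f.
Proof. by move=> fW s x sn; apply: fW; exact: leqW. Qed.

Lemma differentiable_upto_eq n W f g : open W -> (forall y, W y -> f y = g y) ->
  differentiable_upto n W f -> differentiable_upto n W g.
Proof.
move=> oW fg fW s x sn Wx; apply: differentiable_eq_near (fW s x sn Wx).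
have := open_nbhs_nbhs (conj oW Wx).
by apply: filterS => y; exact: partials_eq.
Qed.

Lemma smooth_real_eq W f g : open W -> (forall y, W y -> f y = g y) ->
  smooth_real W f -> smooth_real W g.
Proof.
move=> oW fg /smooth_real_upto fW; apply/smooth_real_upto => n.
exact: differentiable_upto_eq (fW n).
Qed.

Lemma differentiable_upto_cst n W (c : R) : differentiable_upto n W (cst c).
Proof.
elim: n W c => [|n IH] W c.
  by move=> [|//] x _ _; exact: differentiable_cst.
apply/differentiable_uptoS; split=> [x _|i]; first exact: differentiable_cst.
have -> : 'D_(e_ i) (cst c) = cst 0 by apply/funext => x; rewrite derive_cst.
exact: IH.
Qed.

Lemma differentiable_uptoD n W f g : open W -> differentiable_upto n W f ->
  differentiable_upto n W g -> differentiable_upto n W (fun x => f x + g x).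
Proof.
move=> oW; elim: n f g => [|n IH] f g fW gW.
  move=> [|//] x _ Wx.
  by apply: (@differentiableD _ _ _ f g); [exact: (fW [::])|exact: (gW [::])].
move/differentiable_uptoS : fW => [f0 fS]; move/differentiable_uptoS : gW => [g0 gS].
apply/differentiable_uptoS; split=> [x Wx|i].
  by apply: (@differentiableD _ _ _ f g); [exact: f0|exact: g0].
apply: differentiable_upto_eq (IH _ _ (fS i) (gS i)) => // x Wx.
by rewrite -deriveD//; apply: diff_derivable; [exact: f0|exact: g0].
Qed.

Lemma differentiable_uptoM n W f g : open W -> differentiable_upto n W f ->
  differentiable_upto n W g -> differentiable_upto n W (fun x => f x * g x).
Proof.
move=> oW; elim: n f g => [|n IH] f g fW gW.
  move=> [|//] x _ Wx.
  by apply: (@differentiableM _ _ f g); [exact: (fW [::])|exact: (gW [::])].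
have fn := differentiable_uptoW fW; have gn := differentiable_uptoW gW.
move/differentiable_uptoS : fW => [f0 fS]; move/differentiable_uptoS : gW => [g0 gS].
apply/differentiable_uptoS; split=> [x Wx|i].
  by apply: (@differentiableM _ _ f g); [exact: f0|exact: g0].
have H := differentiable_uptoD oW (IH _ _ fn (gS i)) (IH _ _ gn (fS i)).
apply: differentiable_upto_eq H => // x Wx.
by rewrite -[RHS]/('D_(e_ i) (f * g) x) deriveM//; apply: diff_derivable; [exact: f0|exact: g0].
Qed.

Lemma differentiable_upto_sum n W (I : Type) (r : seq I) (F : I -> 'rV[R]_p -> R) : open W ->
  (forall i, differentiable_upto n W (F i)) ->
  differentiable_upto n W (fun x => \sum_(i <- r) F i x).
Proof.
move=> oW FW; elim: r => [|i r IH].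
  apply: (differentiable_upto_eq oW _ (@differentiable_upto_cst n W 0)) => y _.
  by rewrite big_nil.
apply: (differentiable_upto_eq oW _ (differentiable_uptoD oW (FW i) IH)) => y _.
by rewrite big_cons.
Qed.

Lemma differentiable_uptoV n W f : open W -> (forall x, W x -> f x != 0) ->
  differentiable_upto n W f -> differentiable_upto n W (fun x => (f x)^-1).
Proof.
move=> oW fN0; elim: n => [|n IH] fW.
  by move=> [|//] x _ Wx; apply: differentiableV; [exact: (fW [::])|exact: fN0].
have fn := IH (differentiable_uptoW fW).
move/differentiable_uptoS : fW => [f0 fS].
apply/differentiable_uptoS; split=> [x Wx|i].
  by apply: differentiableV; [exact: f0|exact: fN0].
(* The derivative [- f^-2 * f'] contains the inverse only to order [n], where the induction
   hypothesis covers it. *)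
have H := differentiable_uptoM oW (differentiable_uptoM oW
  (@differentiable_upto_cst n W (-1)) (differentiable_uptoM oW fn fn)) (fS i).
apply: differentiable_upto_eq H => // x Wx.
rewrite deriveV ?fN0//; last exact/diff_derivable/f0.
by rewrite /= -[_ *: _]/(_ * _) mulN1r expr2 invfM.
Qed.

Lemma smooth_real_cst W (c : R) : smooth_real W (fun=> c).
Proof. by apply/smooth_real_upto => n; exact: differentiable_upto_cst. Qed.

Lemma smooth_realD W f g : open W -> smooth_real W f -> smooth_real W g ->
  smooth_real W (fun x => f x + g x).
Proof.
move=> oW /smooth_real_upto fW /smooth_real_upto gW; apply/smooth_real_upto => n.
exact: differentiable_uptoD.
Qed.

Lemma smooth_realM W f g : open W -> smooth_real W f -> smooth_real W g ->
  smooth_real W (fun x => f x * g x).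
Proof.
move=> oW /smooth_real_upto fW /smooth_real_upto gW; apply/smooth_real_upto => n.
exact: differentiable_uptoM.
Qed.

Lemma smooth_realN W f : open W -> smooth_real W f -> smooth_real W (fun x => - f x).
Proof.
move=> oW fW; apply: smooth_real_eq (smooth_realM oW (@smooth_real_cst W (-1)) fW) => // y _.
exact: mulN1r.
Qed.

Lemma smooth_realB W f g : open W -> smooth_real W f -> smooth_real W g ->
  smooth_real W (fun x => f x - g x).
Proof. by move=> oW fW gW; apply: smooth_realD => //; exact: smooth_realN. Qed.

Lemma smooth_realV W f : open W -> (forall x, W x -> f x != 0) -> smooth_real W f ->
  smooth_real W (fun x => (f x)^-1).
Proof.
move=> oW fN0 /smooth_real_upto fW; apply/smooth_real_upto => n.
exact: differentiable_uptoV.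
Qed.

Lemma smooth_real_sum W (I : Type) (r : seq I) (F : I -> 'rV[R]_p -> R) : open W ->
  (forall i, smooth_real W (F i)) -> smooth_real W (fun x => \sum_(i <- r) F i x).
Proof.
move=> oW FW; apply/smooth_real_upto => n; apply: differentiable_upto_sum => // i.
by move/smooth_real_upto : (FW i).
Qed.

Lemma smooth_real_prod W (I : Type) (r : seq I) (F : I -> 'rV[R]_p -> R) : open W ->
  (forall i, smooth_real W (F i)) -> smooth_real W (fun x => \prod_(i <- r) F i x).
Proof.
move=> oW FW; elim: r => [|i r IH].
  by apply: (smooth_real_eq oW _ (@smooth_real_cst W 1)) => y _; rewrite big_nil.
by apply: (smooth_real_eq oW _ (smooth_realM oW (FW i) IH)) => y _; rewrite big_cons.
Qed.

Lemma smooth_real_coord W i : open W -> smooth_real W (fun x => x 0 i).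
Proof.
move=> oW; apply/smooth_real_upto => -[|n].
  by move=> [|//] x _ _; exact: differentiable_coord.
apply/differentiable_uptoS; split=> [x _|j]; first exact: differentiable_coord.
apply: differentiable_upto_eq (@differentiable_upto_cst n W (e_ j 0 i)) => // x _.
rewrite deriveE; last exact: differentiable_coord.
have @L : {linear 'rV[R]_p -> R}.
  by exists (fun N : 'rV[R]_p => N 0 i); do 2![eexists]; do ?[constructor];
     rewrite ?mxE// => ? *; rewrite ?mxE//; move=> ?; rewrite !mxE.
by rewrite -[fun x => _]/(L : _ -> _) diff_lin//; exact: coord_continuous.
Qed.

Lemma partialsD W f g s x : open W -> smooth_real W f -> smooth_real W g -> W x ->
  partials s (fun y => f y + g y) x = partials s f x + partials s g x.
Proof.
move=> oW fW gW; elim: s x => [//|i s IH] x Wx.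
apply: etrans (partials_eq [:: i] oW IH Wx) _.
rewrite /= -deriveD//; apply: diff_derivable.
  exact: fW.
exact: gW.
Qed.

Lemma partials_sum W (I : Type) (r : seq I) (F : I -> 'rV[R]_p -> R) s x : open W ->
  (forall i, smooth_real W (F i)) -> W x ->
  partials s (fun y => \sum_(i <- r) F i y) x = \sum_(i <- r) partials s (F i) x.
Proof.
move=> oW FW Wx; elim: r => [|i r IH].
  rewrite big_nil (@partials_eq _ _ W _ (cst 0) _ _ oW _ Wx); last by move=> y _; rewrite big_nil.
  elim: s x Wx => [//|i s IH] x Wx.
  apply: etrans (@partials_eq _ _ W _ (cst 0) [:: i] _ oW IH Wx) _.
  by rewrite /= derive_cst.
rewrite big_cons -IH -(partialsD _ oW)//; last exact: smooth_real_sum.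
by apply: (partials_eq _ oW) => // y Wy; rewrite big_cons.
Qed.

End smooth_closure.

(** * Vector-valued functions through their coordinates *)

Section row_functions.
Context {R : realType} {T : topologicalType} {q : nat}.
Implicit Types f : T -> 'rV[R]_q.

Lemma row_continuous f (x : T) :
  (forall j, {for x, continuous (fun y => f y 0 j)}) -> {for x, continuous f}.
Proof.
move=> fc; apply/(@cvgrPdist_le _ 'rV[R]_q) => e e0.
have fe (j : 'I_q) : \forall y \near x, `|f x 0 j - f y 0 j| <= e.
  by have /cvgrPdist_le/(_ e e0) := fc j.
have H := @filter_forall _ _ (fun j y => `|f x 0 j - f y 0 j| <= e) (nbhs x) _ fe.
near=> y; have fy : forall j, `|f x 0 j - f y 0 j| <= e by near: y; exact: H.
 apply: norm_row_le; first exact: ltW.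
by move=> j; rewrite !mxE.
Unshelve. all: by end_near. Qed.

Lemma continuous_row f (x : T) j :
  {for x, continuous f} -> {for x, continuous (fun y => f y 0 j)}.
Proof.
move=> fc; apply: (@continuous_comp _ _ _ f (fun M : 'rV[R]_q => M 0 j)) => //.
exact: coord_continuous.
Qed.

End row_functions.

Section smooth_rows.
Context {R : realType} {p q : nat}.
Implicit Types (f : 'rV[R]_p -> 'rV[R]_q) (s : seq 'I_p) (W : set 'rV[R]_p).
Local Notation e_ i := (delta_mx 0 i : 'rV[R]_p).

Lemma differentiable_row f (x : 'rV[R]_p) :
  (forall j, differentiable (fun y => f y 0 j) x) -> differentiable f x.
Proof.
move=> fd; have := @differentiable_sum R _ _ q (fun j y => f y 0 j *: delta_mx 0 j : 'rV[R]_q) x.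
rewrite fct_sumE => H.
have -> : f = (fun y => \sum_(j < q) f y 0 j *: delta_mx 0 j).
  by apply/funext => y; rewrite -row_sum_delta.
by apply: H => j; exact: (@differentiableZl _ _ _ (fun y => f y 0 j)).
Qed.

Lemma iter_partial_smooth_on W f s (x : 'rV[R]_p) : open W -> smooth_on W f -> W x ->
  iter_partial s f x = \row_j partials s (fun y => f y 0 j) x.
Proof.
move=> oW fW; elim: s x => [|i s IH] x Wx.
  by apply/rowP => j; rewrite mxE.
have [_ fd] := fW s x Wx.
rewrite [LHS](derive_mx (fd i)); apply/rowP => j; rewrite !mxE.
apply: near_eq_derive; have := open_nbhs_nbhs (conj oW Wx).
by apply: filterS => y /IH ->; rewrite mxE.
Qed.

(** At each order, the continuity of the next partials promotes mere existence of derivatives to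
    differentiability, by [differentiable_partials]. *)
Lemma smooth_on_coord W f j : open W -> smooth_on W f -> smooth_real W (fun x => f x 0 j).
Proof.
move=> oW fW s x Wx.
have E t y : W y -> iter_partial t f y 0 j = partials t (fun y => f y 0 j) y.
  by move=> Wy; rewrite (iter_partial_smooth_on _ oW fW Wy) mxE.
have nE t y : W y -> \forall z \near y, iter_partial t f z 0 j = partials t (fun y => f y 0 j) z.
  move=> Wy; have := open_nbhs_nbhs (conj oW Wy).
  by apply: filterS; exact: E.
apply: differentiable_partials => i.
  have := open_nbhs_nbhs (conj oW Wx); apply: filterS => y Wy.
  apply: near_eq_derivable (nE s y Wy) _.
  by have [_ /(_ i)/derivable_mxP] := fW s y Wy.
have [fc _] := fW (i :: s) x Wx.
have := @continuous_row _ _ _ _ _ j fc; rewrite /prop_for /continuous_at.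
rewrite (E (i :: s) _ Wx) => H; apply: cvg_trans H.
exact: (near_eq_cvg (nE (i :: s) x Wx)).
Qed.

Lemma smooth_onP W f : open W ->
  smooth_on W f <-> forall j, smooth_real W (fun x => f x 0 j).
Proof.
move=> oW; split=> [fW j|fW]; first exact: smooth_on_coord.
have E s x : W x -> iter_partial s f x = \row_j partials s (fun y => f y 0 j) x.
  elim: s x => [|i s IH] x Wx.
    by apply/rowP => j; rewrite mxE.
  have nE : \forall y \near x, iter_partial s f y = \row_j partials s (fun y => f y 0 j) y.
    by have := open_nbhs_nbhs (conj oW Wx); apply: filterS.
  rewrite [LHS](near_eq_derive _ nE) derive_mx.
    apply/rowP => j; rewrite !mxE; congr ('D_ _ _ _).
    by apply/funext => y; rewrite mxE.
  apply/derivable_mxP => k j; rewrite (_ : (fun y => _) = partials s (fun y => f y 0 j)).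
    by apply: diff_derivable; exact: fW.
  by apply/funext => y; rewrite mxE.
move=> s x Wx.
have nE : \forall y \near x, \row_j partials s (fun y => f y 0 j) y = iter_partial s f y.
  by have := open_nbhs_nbhs (conj oW Wx); apply: filterS => y /E ->.
have D : differentiable (fun x => \row_j partials s (fun y => f y 0 j) x : 'rV[R]_q) x.
  apply: differentiable_row => j; rewrite (_ : (fun y => _) = partials s (fun y => f y 0 j)).
    exact: fW.
  by apply/funext => y; rewrite mxE.
have {}D := differentiable_eq_near nE D.
by split=> [|i]; [exact: differentiable_continuous|exact: diff_derivable].
Qed.

Lemma smooth_on_eq W f g : open W -> (forall x, W x -> f x = g x) ->
  smooth_on W f -> smooth_on W g.
Proof.
move=> oW fg /(smooth_onP _ oW) fW; apply/(smooth_onP _ oW) => j.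
by apply: smooth_real_eq (fW j) => // y /fg ->.
Qed.

Lemma smooth_on_subset W W' f : W `<=` W' -> smooth_on W' f -> smooth_on W f.
Proof. by move=> WW' fW s x /WW'; exact: fW. Qed.

Lemma smooth_on_continuous W f x : smooth_on W f -> W x -> {for x, continuous f}.
Proof. by move=> fW Wx; have [] := fW [::] x Wx. Qed.

Lemma smooth_on_local W f :
  (forall x, W x -> exists2 W', W' x & smooth_on W' f) -> smooth_on W f.
Proof. by move=> fW s x /fW[W' W'x]; exact. Qed.

End smooth_rows.

(** * Chain rule and composition of smooth maps *)

Section composition.
Context {R : realType} {p q : nat}.
Local Notation e_ i := (delta_mx 0 i : 'rV[R]_p).
Local Notation u_ i := (delta_mx 0 i : 'rV[R]_q).

Lemma derive_comp_row (f : 'rV[R]_p -> 'rV[R]_q) (g : 'rV[R]_q -> R) (x v : 'rV[R]_p) :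
  (forall j, differentiable (fun y => f y 0 j) x) -> differentiable g (f x) ->
  'D_v (g \o f) x = \sum_j 'D_v (fun y => f y 0 j) x * 'D_(u_ j) g (f x).
Proof.
move=> fd gd; have df := differentiable_row fd.
rewrite deriveE; last exact: differentiable_comp.
rewrite diff_comp//= -[X in 'd _ _ X](deriveE v df) derive_mx; last exact: diff_derivable.
rewrite [X in 'd _ _ X]row_sum_delta linear_sum; apply: eq_bigr => j _.
by rewrite linearZ !mxE -deriveE.
Qed.

(** The induction varies [g] and fixes [f]: the chain rule produces the composites of the partials
    of [g] with the same [f], one order lower, multiplied by partials of [f]. *)
Lemma differentiable_upto_comp n W W' (f : 'rV[R]_p -> 'rV[R]_q) (g : 'rV[R]_q -> R) :
  open W -> (forall x, W x -> W' (f x)) ->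
  (forall j, differentiable_upto n W (fun x => f x 0 j)) -> differentiable_upto n W' g ->
  differentiable_upto n W (g \o f).
Proof.
move=> oW fWW'; elim: n g => [|n IH] g fW gW.
  move=> [|//] x _ Wx; apply: differentiable_comp; last exact: (gW [::] _ isT (fWW' _ Wx)).
  by apply: differentiable_row => j; exact: (fW j [::]).
have fd x j : W x -> differentiable (fun y => f y 0 j) x by exact: (fW j [::]).
have fn j := differentiable_uptoW (fW j).
have fS j i : differentiable_upto n W ('D_(e_ i) (fun x => f x 0 j)).
  by have /differentiable_uptoS[_] := fW j; exact.
move/differentiable_uptoS : gW => [gd gS].
apply/differentiable_uptoS; split=> [x Wx|i].
  apply: differentiable_comp; last exact/gd/fWW'.
  by apply: differentiable_row => j; exact: fd.
apply: (differentiable_upto_eq oW _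
  (differentiable_upto_sum (index_enum 'I_q) oW (fun j =>
     differentiable_uptoM oW (fS j i) (IH _ fn (gS j))))) => x Wx.
by rewrite derive_comp_row//; [move=> j; exact: fd|exact/gd/fWW'].
Qed.

Lemma smooth_real_comp W W' (f : 'rV[R]_p -> 'rV[R]_q) (g : 'rV[R]_q -> R) :
  open W -> (forall x, W x -> W' (f x)) ->
  smooth_on W f -> smooth_real W' g -> smooth_real W (g \o f).
Proof.
move=> oW fW /(smooth_onP _ oW) fs /smooth_real_upto gs; apply/smooth_real_upto => n.
apply: (differentiable_upto_comp (W' := W')) => // j.
by move/smooth_real_upto : (fs j).
Qed.

Lemma smooth_on_comp k W W' (f : 'rV[R]_p -> 'rV[R]_q) (g : 'rV[R]_q -> 'rV[R]_k) :
  open W -> open W' -> (forall x, W x -> W' (f x)) ->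
  smooth_on W f -> smooth_on W' g -> smooth_on W (g \o f).
Proof.
move=> oW oW' fW fs /(smooth_onP _ oW') gs; apply/(smooth_onP _ oW) => j.
exact: (smooth_real_comp oW fW fs (gs j)).
Qed.

End composition.

Section slices.
Context {R : realType} {p q : nat}.
Local Notation ep_ i := (delta_mx 0 i : 'rV[R]_p).
Local Notation eq_ i := (delta_mx 0 i : 'rV[R]_q).

Lemma row_mx_delta_l (x : 'rV[R]_p) (y : 'rV[R]_q) i (h : R) :
  row_mx (h *: ep_ i + x) y = h *: delta_mx 0 (lshift q i) + row_mx x y.
Proof.
apply/rowP => j; rewrite !mxE; case: (fintype.splitP j) => k jk; rewrite ?mxE ?eqxx /=.
  by congr (_ * (_)%:R + _); rewrite -!val_eqE /= jk.
by rewrite -val_eqE /= jk gtn_eqF ?mulr0 ?add0r// ltn_addr.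
Qed.

Lemma row_mx_delta_r (x : 'rV[R]_p) (y : 'rV[R]_q) i (h : R) :
  row_mx x (h *: eq_ i + y) = h *: delta_mx 0 (rshift p i) + row_mx x y.
Proof.
apply/rowP => j; rewrite !mxE; case: (fintype.splitP j) => k jk; rewrite ?mxE ?eqxx /=.
  by rewrite -val_eqE /= jk ltn_eqF ?mulr0 ?add0r// ltn_addr.
by congr (_ * (_)%:R + _); rewrite -!val_eqE /= jk eqn_add2l.
Qed.

(** The factors depend on disjoint blocks of coordinates, so every derivative falls on exactly one
    of them. Bounds for a time bump times a function of space thus separate into one bound for
    each. *)
Lemma partials_tensor (U : set 'rV[R]_p) (V : set 'rV[R]_q)
    (u : 'rV[R]_p -> R) (v : 'rV[R]_q -> R) (s : seq 'I_(p + q)) x y :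
  open U -> open V -> smooth_real U u -> smooth_real V v -> U x -> V y ->
  partials s (fun z => u (lsubmx z) * v (rsubmx z)) (row_mx x y) =
  partials (pmap (fun i => if fintype.split i is inl j then Some j else None) s) u x *
  partials (pmap (fun i => if fintype.split i is inr j then Some j else None) s) v y.
Proof.
move=> oU oV uU vV; elim: s x y => [|i s IH] x y Ux Vy /=.
  by rewrite row_mxKl row_mxKr.
set sl := pmap _ s in IH *; set sr := pmap _ s in IH *.
rewrite -[i]splitK; case: (fintype.split i) => j /=.
  rewrite (unsplitK (inl j)) /=.
  have E : \forall z \near x, partials s (fun z => u (lsubmx z) * v (rsubmx z)) (row_mx z y) =
      partials sl u z * partials sr v y.
    by have := open_nbhs_nbhs (conj oU Ux); apply: filterS => z Uz; exact: IH.
  rewrite -(@derive_transport _ _ _ _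
    (fun z => partials s (fun z => u (lsubmx z) * v (rsubmx z)) (row_mx z y)) _ x (ep_ j)).
    rewrite (near_eq_derive _ E) (deriveMr (partials sr v y)) 1?mulrC//.
    exact/diff_derivable/uU.
  by move=> h; rewrite row_mx_delta_l.
rewrite (unsplitK (inr j)) /=.
have E : \forall z \near y, partials s (fun z => u (lsubmx z) * v (rsubmx z)) (row_mx x z) =
    partials sl u x * partials sr v z.
  by have := open_nbhs_nbhs (conj oV Vy); apply: filterS => z Uz; exact: IH.
rewrite -(@derive_transport _ _ _ _
  (fun z => partials s (fun z => u (lsubmx z) * v (rsubmx z)) (row_mx x z)) _ y (eq_ j)).
  rewrite (near_eq_derive _ E) (deriveMl (partials sl u x))//.
  exact/diff_derivable/vV.
by move=> h; rewrite row_mx_delta_r.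
Qed.

End slices.

(** * Flat functions and bumps *)

Lemma diff_approx_eq (R : realType) (V W : normedModType R) (f : V -> W)
    (L : {linear V -> W}) (x : V) : continuous L ->
  (forall e : R, 0 < e -> \forall h \near 0, `|f (h + x) - f x - L h| <= e * `|h|) ->
  'd f x = L :> (V -> W).
Proof.
move=> cL fL; apply: diff_unique => //.
apply/eqaddoP => e e0; have := fL e e0; apply: filterS => h.
by rewrite [X in _ -> X]/= opprD addrA.
Qed.

Section flat_extension.
Context {R : realType} {p : nat}.
Implicit Types (G : 'rV[R]_p -> R) (x y : 'rV[R]_p) (W : set 'rV[R]_p).

Lemma quadratically_flat G x (C : R) : G x = 0 ->
  (\forall y \near x, `|G y| <= C * `|y - x| ^+ 2) ->
  differentiable G x /\ forall v, 'D_v G x = 0.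
Proof.
move=> Gx GC.
have c0 : continuous (\0 : {linear 'rV[R]_p -> R}) by exact: cst_continuous.
have H : forall e : R, 0 < e ->
    \forall h \near (0 : 'rV[R]_p),
      `|G (h + x) - G x - (\0 : {linear 'rV[R]_p -> R}) h| <= e * `|h|.
  move=> e e0.
  have h1 : \forall h \near (0 : 'rV[R]_p), `|G (h + x)| <= C * `|h| ^+ 2.
    have := GC; rewrite (near_shift 0 x) /=.
    by apply: filterS => h /=; rewrite subr0 addrK.
  have h2 : \forall h \near (0 : 'rV[R]_p), `|h| < e / (`|C| + 1).
    apply/nbhs_ballP; exists (e / (`|C| + 1)); first by rewrite /= divr_gt0// ltr_wpDl.
    by move=> h; rewrite -ball_normE /ball_/= sub0r normrN.
  apply: filterS (filterI h1 h2) => h [/= Gh he]; rewrite Gx !subr0 (le_trans Gh)//.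
  rewrite expr2 mulrA ler_wpM2r//.
  have : `|C| + 1 > 0 by rewrite ltr_wpDl.
  move=> C0; rewrite ltr_pdivlMr// mulrDr mulr1 in he.
  have : C * `|h| <= `|h| * `|C| by rewrite mulrC ler_wpM2l// ler_norm.
  by move=> ?; have := normr_ge0 h; lra.
have dG := differentiable_approx c0 H; split=> // v.
by rewrite deriveE// (diff_approx_eq c0 H).
Qed.

(* The quadratic bounds make the derivatives of all orders of G vanish, by
   induction on the order, at the points of W outside of W'. *)
Lemma smooth_flat_extension W W' G : open W -> open W' -> smooth_real W' G ->
  (forall y, W y -> ~ W' y -> G y = 0) ->
  (forall s y0, W y0 -> ~ W' y0 -> exists C : R,
     \forall y \near y0, W' y -> `|partials s G y| <= C * `|y - y0| ^+ 2) ->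
  smooth_real W G.
Proof.
move=> oW oW' sG G0 GC.
have key s : forall y0, W y0 -> ~ W' y0 ->
    partials s G y0 = 0 -> (forall y, W y -> ~ W' y -> partials s G y = 0) ->
    differentiable (partials s G) y0 /\ forall v, 'D_v (partials s G) y0 = 0.
  move=> y0 Wy0 nWy0 Gy0 Gs; have [C nC] := GC s y0 Wy0 nWy0.
  (* The absolute value makes the bound nonnegative, hence valid at the points outside [W'], where
     the partial derivative is 0. *)
  apply: (@quadratically_flat _ _ `|C|) => //.
  apply: filterS (filterI nC (open_nbhs_nbhs (conj oW Wy0))) => y [/= yC Wy].
  have [/yC H|/Gs ->//] := pselect (W' y); last by rewrite normr0 mulr_ge0.
  by rewrite (le_trans H)// ler_wpM2r ?exprn_ge0// ler_norm.
have Gs s : forall y, W y -> ~ W' y -> partials s G y = 0.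
  elim: s => [//|i s IH] y Wy nWy /=.
  by apply: (key s y Wy nWy _ IH).2; exact: IH.
move=> s x Wx; have [W'x|nW'x] := pselect (W' x); first exact: sG.
by apply: (key s x Wx nW'x _ (Gs s)).1; exact: Gs.
Qed.

End flat_extension.

(** * A smooth plateau function of one variable *)

Section plateau.
Context {R : realType}.
Local Notation e0 := (delta_mx 0 ord0 : 'rV[R]_1).

(** Viewing the variable as a row of length 1 makes the calculus of several variables available as
    it stands. *)
Definition smooth1 (f : R -> R) := smooth_real [set: 'rV[R]_1] (fun y => f (y 0 ord0)).

Lemma smooth1_comp p (W : set 'rV[R]_p) f (g : 'rV[R]_p -> R) : open W ->
  smooth1 f -> smooth_real W g -> smooth_real W (f \o g).
Proof.
move=> oW f1 gW.
have H : smooth_on W (fun x => const_mx (g x) : 'rV[R]_1).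
  apply/(smooth_onP _ oW) => j.
  by apply: (smooth_real_eq oW _ gW) => y _; rewrite mxE.
have := smooth_real_comp oW (fun _ _ => I : setT _) H f1.
by apply: smooth_real_eq => // y _; rewrite /= mxE.
Qed.

Definition flat_exp (t : R) : R := if 0 < t then expR (- t^-1) else 0.

(** With z = 1/t this is the quadratic bound that [smooth_flat_extension] asks for at t = 0. The
    constant comes from [z ^+ j.+2 <= (j.+2)! * expR z], one term of the exponential series for each
    coefficient. *)
Lemma horner_expN_bound (P : {poly R}) : exists C : R, forall z, 0 <= z ->
  `|P.[z]| * expR (- z) * z ^+ 2 <= C.
Proof.
exists (\sum_(j < size P) `|P`_j| * (j.+2)`!%:R) => z z0.
rewrite expRN mulrAC ler_pdivrMr ?expR_gt0// horner_coef.
rewrite mulr_suml (le_trans (ler_wpM2r _ (ler_norm_sum _ _ _))) ?exprn_ge0//.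
rewrite !mulr_suml; apply: ler_sum => j _.
rewrite normrM -!mulrA ler_wpM2l// normrX ger0_norm// -exprD addn2.
have := expR_ge1Dxn j.+1 z0; rewrite -lerBrDl => H.
have : z ^+ j.+2 / j.+2`!%:R <= expR z by rewrite (le_trans H)// gerBl.
by rewrite ler_pdivrMr ?ltr0n ?fact_gt0// mulrC.
Qed.

(** Polynomials in 1/t times exp(-1/t) are stable under differentiation, so every derivative of
    [flat_exp] on the positive axis has this form. *)
Let is_derive_horner_exp (P : {poly R}) (t : R) : 0 < t ->
  is_derive t 1 (fun t => P.[t^-1] * expR (- t^-1))
    (('X^2 * (P - P^`())).[t^-1] * expR (- t^-1)).
Proof.
move=> t0.
have dV : is_derive t (1 : R) (fun t : R => t^-1) (- t ^- 2).
  have := @is_deriveV R id t 1 1 (lt0r_neq0 t0) _.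
  by rewrite [_ *: _]mulr1; apply; exact: is_derive_id.
have dP : is_derive t (1 : R) (fun t : R => P.[t^-1]) (P^`().[t^-1] * - t ^- 2).
  exact: (@is_derive1_comp R (horner P) (fun t => t^-1) t _ _ (is_derive_poly _ _) dV).
have dE : is_derive t (1 : R) (fun t : R => expR (- t^-1)) (expR (- t^-1) * t ^- 2).
  apply: (@is_derive1_comp R expR (fun t => - t^-1)).
  by rewrite -[t ^- 2]opprK; exact: is_deriveN.
apply: (is_derive_eq (is_deriveM dP dE)).
rewrite -[_ *: _]/(_ * _) -[X in _ + X]/(_ * _) hornerM hornerXn hornerD hornerN exprVn.
by ring.
Qed.

Let flat_exp_partials (s : seq 'I_1) : exists P : {poly R}, forall y : 'rV[R]_1,
  0 < y 0 ord0 ->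
  partials s (fun y => flat_exp (y 0 ord0)) y = P.[(y 0 ord0)^-1] * expR (- (y 0 ord0)^-1).
Proof.
elim: s => [|i s [P IH]].
  by exists 1 => y y0 /=; rewrite hornerC mul1r /flat_exp y0.
exists ('X^2 * (P - P^`())) => y y0; rewrite partials_cons.
have nE : \forall z \near y, partials s (fun y => flat_exp (y 0 ord0)) z =
    P.[(z 0 ord0)^-1] * expR (- (z 0 ord0)^-1).
  have : nbhs y (fun z : 'rV[R]_1 => 0 < z 0 ord0).
    exact: (@coord_continuous R 1 1 0 ord0 y _ (lt_nbhsr y0)).
  by apply: filterS.
rewrite (near_eq_derive _ nE) (ord1 i).
have [_ <-] := is_derive_horner_exp P y0.
refine (@derive_transport R 'rV[R]_1 R R
  (fun z : 'rV[R]_1 => P.[(z 0 ord0)^-1] * expR (- (z 0 ord0)^-1))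
  (fun t => P.[t^-1] * expR (- t^-1)) _ _ _ _ _) => h.
by rewrite !mxE eqxx/= mulr1 -[h *: 1]/(h * 1) mulr1.
Qed.

Lemma smooth_flat_exp : smooth1 flat_exp.
Proof.
pose W' := [set y : 'rV[R]_1 | 0 < y 0 ord0].
have oW' : open W'.
  apply: (@open_comp _ _ (fun y : 'rV[R]_1 => y 0 ord0) [set x | 0 < x]); last exact: open_gt.
  by move=> y _; exact: coord_continuous.
apply: (@smooth_flat_extension _ _ _ W') => //; first exact: openT.
- move=> s y Wy; have [P PE] := flat_exp_partials s.
  apply: (@differentiable_eq_near _ _ _
    (fun y : 'rV[R]_1 => P.[(y 0 ord0)^-1] * expR (- (y 0 ord0)^-1))).
    by have := open_nbhs_nbhs (conj oW' Wy); apply: filterS => z /PE ->.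
  apply: (@differentiable_comp _ _ _ _ (fun y : 'rV[R]_1 => y 0 ord0)
    (fun t => P.[t^-1] * expR (- t^-1))); first exact: differentiable_coord.
  by apply/derivable1_diffP; have [] := is_derive_horner_exp P Wy.
- move=> y _ /negP; rewrite -leNgt => y0.
  by rewrite /flat_exp ltNge y0.
- move=> s y0 _ /negP; rewrite -leNgt => y00.
  have [P PE] := flat_exp_partials s; have [C PC] := horner_expN_bound P.
  exists C; apply: filterE => y Wy; rewrite (PE _ Wy).
  have := PC (y 0 ord0)^-1; rewrite invr_ge0 ltW// => /(_ isT).
  rewrite exprVn ler_pdivrMr ?exprn_gt0// normrM (ger0_norm (expR_ge0 _)) => H.
  have C0 : 0 <= C.
    have : 0 <= C * y 0 ord0 ^+ 2 by apply: le_trans H; rewrite mulr_ge0 ?expR_ge0.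
    by rewrite pmulr_lge0 ?exprn_gt0.
  rewrite (le_trans H)// ler_wpM2l//; apply: lerXn2r; rewrite ?nnegrE ?(ltW Wy)//.
  rewrite (le_trans _ (norm_coord_le _ ord0))// !mxE (le_trans _ (ler_norm _))//.
  by rewrite lerBrDr gerDl.
Qed.

(** Climbs from 0 on t <= 0 to 1 on t >= 1; the denominator is positive since t or 1 - t is. *)
Definition smooth_step (t : R) : R := flat_exp t / (flat_exp t + flat_exp (1 - t)).

Lemma flat_exp_ge0 t : 0 <= flat_exp t.
Proof. by rewrite /flat_exp; case: ifP => // _; rewrite expR_ge0. Qed.

Lemma flat_exp_gt0 t : 0 < t -> 0 < flat_exp t.
Proof. by move=> t0; rewrite /flat_exp t0 expR_gt0. Qed.

Lemma flat_exp_eq0 t : t <= 0 -> flat_exp t = 0.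
Proof. by move=> t0; rewrite /flat_exp ltNge t0. Qed.

Definition plateau (t : R) : R := smooth_step (2 - t) * smooth_step (2 + t).

Lemma plateau1 t : `|t| <= 1 -> plateau t = 1.
Proof.
rewrite ler_norml => /andP[t1 t2]; rewrite /plateau /smooth_step.
rewrite (@flat_exp_eq0 (1 - (2 - t))) ?(@flat_exp_eq0 (1 - (2 + t))); [|lra|lra].
by rewrite !addr0 !divff ?mulr1// lt0r_neq0// flat_exp_gt0; lra.
Qed.

Lemma plateau0 t : 2 <= `|t| -> plateau t = 0.
Proof.
rewrite /plateau /smooth_step ler_normr => /orP[t2|t2].
  by rewrite (@flat_exp_eq0 (2 - t)) ?mul0r//; lra.
by rewrite (@flat_exp_eq0 (2 + t)) ?mul0r ?mulr0//; lra.
Qed.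

Lemma smooth_plateau : smooth1 plateau.
Proof.
have oT : open [set: 'rV[R]_1] by exact: openT.
have sc : smooth_real [set: 'rV[R]_1] (fun y => y 0 ord0) by exact: smooth_real_coord.
have sC (c : R) : smooth_real [set: 'rV[R]_1] (fun=> c) by exact: smooth_real_cst.
have step : smooth1 smooth_step.
  have s1 : smooth_real [set: 'rV[R]_1] (fun y => flat_exp (1 - y 0 ord0)).
    exact: (smooth1_comp oT smooth_flat_exp (smooth_realB oT (sC 1) sc)).
  apply: (smooth_realM oT smooth_flat_exp); apply: (smooth_realV oT) => [y _|].
    apply: lt0r_neq0; have [y0|y0] := ltP 0 (y 0 ord0).
      by rewrite ltr_pwDl ?flat_exp_ge0// flat_exp_gt0.
    by rewrite ltr_wpDl ?flat_exp_ge0// flat_exp_gt0; lra.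
  exact: (smooth_realD oT smooth_flat_exp s1).
apply: (smooth_realM oT).
  exact: (smooth1_comp oT step (smooth_realB oT (sC 2) sc)).
exact: (smooth1_comp oT step (smooth_realD oT (sC 2) sc)).
Qed.

End plateau.

Lemma lsubmx_smooth (R : realType) p q (W : set 'rV[R]_(p + q)) : open W ->
  smooth_on W (@lsubmx R 1 p q).
Proof.
move=> oW; apply/(smooth_onP _ oW) => j.
by apply: (smooth_real_eq oW _ (smooth_real_coord (lshift q j) oW)) => y _; rewrite mxE.
Qed.

Lemma rsubmx_smooth (R : realType) p q (W : set 'rV[R]_(p + q)) : open W ->
  smooth_on W (@rsubmx R 1 p q).
Proof.
move=> oW; apply/(smooth_onP _ oW) => j.
by apply: (smooth_real_eq oW _ (smooth_real_coord (rshift p j) oW)) => y _; rewrite mxE.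
Qed.

Lemma lsubmx_continuous (R : realType) p q : continuous (@lsubmx R 1 p q).
Proof. by move=> y; apply: (smooth_on_continuous (lsubmx_smooth openT)). Qed.

Lemma rsubmx_continuous (R : realType) p q : continuous (@rsubmx R 1 p q).
Proof. by move=> y; apply: (smooth_on_continuous (rsubmx_smooth openT)). Qed.

Lemma partials_cst0 (R : realType) p (s : seq 'I_p) :
  partials s (cst 0) = cst 0 :> ('rV[R]_p -> R).
Proof.
elim: s => [//|j s IH]; rewrite partials_cons IH.
by apply/funext => x; rewrite derive_cst.
Qed.

(** * Bumps in time, centred at the powers of 1/2 *)

Section bumps.
Context {R : realType}.

Definition time (k : nat) : R := 2 ^- k.

(** The factor 8 confines the support to times between 3/4 and 5/4 of [time k]. Consecutive centres
    differ by a factor 2 and 5/8 < 3/4, so distinct bumps never overlap. *)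
Definition bump_at (k : nat) (t : R) : R := plateau ((t - time k) * (8 / time k)).

Lemma time_gt0 k : 0 < time k.
Proof. by rewrite /time invr_gt0 exprn_gt0. Qed.

Lemma timeS k : time k.+1 = time k / 2.
Proof. by rewrite /time exprSr invfM. Qed.

Lemma time_le j k : (j <= k)%N -> time k <= time j.
Proof. by move=> jk; rewrite /time lef_pV2 ?posrE ?exprn_gt0// ler_eXn2l ?ltr1n. Qed.

Lemma time_lt k (t : R) : 0 < t -> 2 / t < k%:R -> time k < t / 2.
Proof.
move=> t0 tk; rewrite /time -[ltRHS]invrK ltf_pV2 ?posrE ?invr_gt0 ?divr_gt0 ?exprn_gt0//.
rewrite invf_div (lt_trans tk)// -natrX ltr_nat ltn_expl//.
Qed.

Lemma bump_at_out k (t : R) : time k <= 4 * `|t - time k| -> bump_at k t = 0.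
Proof.
move=> kt; rewrite /bump_at plateau0// normrM [X in _ * X]gtr0_norm ?divr_gt0 ?time_gt0//.
by rewrite mulrA ler_pdivlMr ?time_gt0//; lra.
Qed.

Lemma bump_at_time k : bump_at k (time k) = 1.
Proof. by rewrite /bump_at subrr mul0r plateau1// normr0. Qed.

Lemma bump_at_before k (t : R) : 4 * t <= 3 * time k -> bump_at k t = 0.
Proof.
move=> kt; apply: bump_at_out; have := ler_norm (- (t - time k)); rewrite normrN.
by have := time_gt0 k; lra.
Qed.

Lemma bump_at_after k (t : R) : 5 * time k <= 4 * t -> bump_at k t = 0.
Proof.
by move=> kt; apply: bump_at_out; have := ler_norm (t - time k); lra.
Qed.

Lemma bump_at_times j k : j != k -> bump_at k (time j) = 0.
Proof.
rewrite neq_ltn => /orP[jk|kj].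
  apply: bump_at_after; have := time_le jk; rewrite timeS => ?.
  by have := time_gt0 j; have := time_gt0 k; lra.
apply: bump_at_before; have := time_le kj; rewrite timeS => ?.
by have := time_gt0 j; have := time_gt0 k; lra.
Qed.

Lemma smooth_bump_at k : smooth1 (bump_at k).
Proof.
apply: (smooth1_comp openT smooth_plateau).
apply: (smooth_realM openT); last exact: smooth_real_cst.
apply: (smooth_realB openT); last exact: smooth_real_cst.
exact: smooth_real_coord openT.
Qed.

Let ball2_compact : compact [set u : 'rV[R]_1 | `|u| <= 2].
Proof.
apply: bounded_closed_compact.
  by exists 2; split; rewrite ?num_real// => x x2 u /= u2; rewrite (le_trans u2)// ltW.
apply: (@closed_comp _ _ (fun u : 'rV[R]_1 => `|u|) [set x | x <= 2]); last exact: closed_le.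
by move=> u _; exact: norm_continuous.
Qed.

(** All times are at most 1, so the bump vanishes outside the ball of radius 2; on this compact ball
    each derivative is continuous, hence bounded. *)
Lemma bump_at_partials_bounded k (s : seq 'I_1) : exists C : R, forall u : 'rV[R]_1,
  `|partials s (fun u => bump_at k (u 0 ord0)) u| <= C.
Proof.
set D := partials _ _.
have cD : continuous D.
  by move=> u; apply: (@smooth_real_continuous _ _ setT) => //;
    apply: smooth_real_partials; exact: smooth_bump_at.
have [C [_ CD]] : bounded_set (D @` [set u | `|u| <= 2]).
  apply/compact_bounded/continuous_compact => //.
  by apply: continuous_subspaceT => u; exact: cD.
(* [bounded_set] provides a bound by every number strictly above [C], whence [C + 1]; the maximum
   with 0 serves outside the ball. *)
exists (Num.max 0 (C + 1)) => u; have [u2|u2] := leP `|u| 2.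
  by rewrite le_max; apply/orP; right; apply: CD; [rewrite ltrDl|exists u].
have oU : open [set u : 'rV[R]_1 | 2 < `|u|].
  apply: (@open_comp _ _ (fun u : 'rV[R]_1 => `|u|) [set x | 2 < x]); last exact: open_gt.
  by move=> v _; exact: norm_continuous.
have -> : D u = 0.
  rewrite /D (@partials_eq _ _ _ _ (cst 0) _ _ oU _ u2); last first.
    move=> v /= v2; apply: bump_at_out.
    have : `|v| <= `|v 0 ord0|.
      by apply: norm_row_le => // j; rewrite (ord1 j).
    have : time k <= 1 by have := time_le (leq0n k); rewrite /time expr0 invr1.
    have := lerB_dist (v 0 ord0) (time k); rewrite (gtr0_norm (time_gt0 k)).
    by lra.
  case: s D cD CD => [|i s] //= _ _ _.
  by rewrite -/(partials s _) partials_cst0 derive_cst.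
by rewrite normr0 le_max lexx.
Qed.

(** A diagonal condition: the k-th constant handles only orders up to [k], so it is a maximum over
    finitely many orders, and a fixed order is still covered for all large [k]. *)
Definition bump_bound_spec k (C : R) := 0 < C /\ forall (s : seq 'I_1) (u : 'rV[R]_1),
  (size s <= k)%N -> `|partials s (fun u => bump_at k (u 0 ord0)) u| <= C.

Lemma bump_bound k : exists C : R, bump_bound_spec k C.
Proof.
have [c cP] := choice (fun l => bump_at_partials_bounded k (nseq l ord0)).
exists (1 + \sum_(l < k.+1) `|c l|); split=> [|s u sk].
  by rewrite ltr_pwDl// sumr_ge0.
(* There is a single direction, so a list of directions is determined by its length. *)
have -> : s = nseq (size s) ord0 by apply/all_pred1P/allP => i _; rewrite [i]ord1 /= eqxx.
rewrite (le_trans (cP _ _))// (bigD1 (Ordinal (sk : size s < k.+1)%N))//=.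
rewrite (le_trans (ler_norm _))// addrCA lerDl addr_ge0// sumr_ge0//.
Qed.

End bumps.

(** * Smooth curves through rapidly converging sequences *)

Section special_curve_real.
Context {R : realType} {m : nat}.
Variables (C : nat -> R) (O : set 'rV[R]_m) (h : nat -> 'rV[R]_m -> R).
Hypothesis CP : forall k, bump_bound_spec k (C k).
Hypothesis oO : open O.
Hypothesis hO : forall k, smooth_real O (h k).
Hypothesis h_small : forall k s x, (size s <= k)%N -> O x ->
  `|partials s (h k) x| <= time k ^+ 3 / (4 * C k).

Local Notation tc z := (lsubmx (z : 'rV[R]_(1 + m)) 0 ord0).
Let term k (z : 'rV[R]_(1 + m)) : R := bump_at k (tc z) * h k (rsubmx z).

(* The terms of index at least 2 / t vanish at time t > 0, and all of them do
   at times t <= 0. *)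
Definition bump_series (z : 'rV[R]_(1 + m)) : R :=
  \sum_(k < Num.bound (2 / tc z)) term k z.

Let W := [set z : 'rV[R]_(1 + m) | O (rsubmx z)].
Let W' := W `&` [set z | 0 < tc z].

Let tc_continuous : continuous (fun z : 'rV[R]_(1 + m) => tc z).
Proof.
move=> z; apply: (@continuous_comp _ _ _ (@lsubmx R 1 1 m) (fun u : 'rV[R]_1 => u 0 ord0)).
  exact: lsubmx_continuous.
exact: coord_continuous.
Qed.

Let open_tc_gt (a : R) : open [set z : 'rV[R]_(1 + m) | a < tc z].
Proof.
apply: (@open_comp _ _ (fun z : 'rV[R]_(1 + m) => tc z) [set x | a < x]); last exact: open_gt.
by move=> z _; exact: tc_continuous.
Qed.

Let oW : open W.
Proof. by apply: open_comp => // z _; exact: rsubmx_continuous. Qed.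

Let oW' : open W'.
Proof. by apply: openI => //; exact: open_tc_gt. Qed.

Let term_smooth k : smooth_real W (term k).
Proof.
apply: (smooth_realM oW).
  have := smooth_real_comp oW (fun _ _ => I : setT _) (lsubmx_smooth oW) (@smooth_bump_at R k).
  exact.
apply: (@smooth_real_comp _ _ _ W O (@rsubmx R 1 1 m) (h k)) => //.
exact: rsubmx_smooth.
Qed.

Let term_partials k s z : W z -> partials s (term k) z =
  partials (pmap (fun i => if fintype.split i is inl j then Some j else None) s)
    (fun u : 'rV[R]_1 => bump_at k (u 0 ord0)) (lsubmx z) *
  partials (pmap (fun i => if fintype.split i is inr j then Some j else None) s)
    (h k) (rsubmx z).
Proof.
move=> Wz; rewrite -{1}[z]hsubmxK.
exact: (partials_tensor _ openT oO (@smooth_bump_at R k) (hO k)).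
Qed.

(** The number of terms in [bump_series] jumps as time varies. Any [K] beyond [2 / tc z] gives the
    same sum, as the extra bumps vanish, so one fixed [K] works on a neighbourhood and allows
    termwise differentiation. *)
Let bump_series_finite K z : 0 < tc z -> 2 / tc z < K%:R ->
  bump_series z = \sum_(k < K) term k z.
Proof.
have key K1 K2 : (K1 <= K2)%N -> 0 < tc z -> 2 / tc z < K1%:R ->
    \sum_(k < K1) term k z = \sum_(k < K2) term k z.
  move=> K12 t0 tK1; rewrite -(big_mkord xpredT (fun k => term k z)).
  rewrite -(big_mkord xpredT (fun k => term k z)) [RHS](big_cat_nat (n := K1))//=.
  rewrite [X in _ = _ + X]big_nat_cond [X in _ = _ + X]big1 ?addr0// => k.
  rewrite andbT => /andP[K1k _]; rewrite /term bump_at_after ?mul0r//.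
  have := time_lt t0 tK1; have := @time_le R _ _ K1k; lra.
move=> t0 tK; have tb : 2 / tc z < (Num.bound (2 / tc z))%:R.
  by apply: archi_boundP; rewrite divr_ge0// ltW.
rewrite /bump_series; have [H|/ltnW H] := leqP K (Num.bound (2 / tc z)).
  by rewrite -(key _ _ H).
by rewrite (key _ _ H).
Qed.

Let bump_series_partials K s z : W' z -> 2 / tc z < K%:R ->
  partials s bump_series z = \sum_(k < K) partials s (term k) z.
Proof.
move=> [Wz /= z0] zK.
have K0 : 0 < K%:R :> R by apply: lt_trans zK; rewrite divr_gt0.
pose U := W `&` [set z | 2 / K%:R < tc z].
have oU : open U by apply: openI => //; exact: open_tc_gt.
have Uz : U z by split => //=; rewrite ltr_pdivrMr// mulrC -ltr_pdivrMr.
rewrite (@partials_eq _ _ U _ (fun z => \sum_(k < K) term k z) _ _ oU _ Uz).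
  exact: (partials_sum _ _ oW (fun k : 'I_K => term_smooth k) Wz).
move=> y [Wy /= yK]; have y0 : 0 < tc y by apply: lt_trans yK; rewrite divr_gt0.
by apply: bump_series_finite => //; rewrite ltr_pdivrMr// mulrC -ltr_pdivrMr.
Qed.

Lemma bump_series_le0 z : tc z <= 0 -> bump_series z = 0.
Proof.
move=> z0; rewrite /bump_series big1// => k _.
by rewrite /term bump_at_before ?mul0r//; have := @time_gt0 R k; lra.
Qed.

Lemma bump_series_time j x : bump_series (row_mx (const_mx (time j)) x) = h j x.
Proof.
have tE : tc (row_mx (const_mx (time j)) x) = time j by rewrite row_mxKl mxE.
rewrite /bump_series tE; have jb : (j < Num.bound (2 / time j : R))%N.
  rewrite -(ltr_nat R); apply: le_lt_trans (archi_boundP _); last first.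
    by rewrite divr_ge0// ltW// time_gt0.
  rewrite /time invrK -exprS -natrX ler_nat ltnW// (@ltn_trans j.+1)//; exact: ltn_expl.
rewrite (bigD1 (Ordinal jb))//= big1 ?addr0.
  by rewrite /term tE bump_at_time mul1r row_mxKr.
move=> k kj; rewrite /term tE bump_at_times ?mul0r//.
by rewrite eq_sym -val_eqE in kj.
Qed.

Let sum_time K : \sum_(k < K) time k <= 2 :> R.
Proof.
suff : \sum_(k < K) time k = 2 - 2 * time K :> R.
  by move=> ->; rewrite gerBl mulr_ge0// ltW// time_gt0.
elim: K => [|K IH]; first by rewrite big_ord0 /time expr0 invr1 mulr1 subrr.
by rewrite big_ord_recr/= IH timeS; field.
Qed.

(** Unless the bump vanishes near [tc z], [time k / 2 <= tc z]; smallness of [tc z] then forces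
    [size s <= k], so that both bounds of index [k] apply. In the product [time k ^+ 3 / 4], two
    factors [time k / 2] are absorbed by [tc z ^+ 2]; the third remains to make the sum over [k]
    converge. *)
Let term_bound k s z : W z -> 0 < tc z -> tc z < time (size s) / 2 ->
  `|partials s (term k) z| <= tc z ^+ 2 * time k.
Proof.
move=> Wz z0 zs; rewrite term_partials//.
set sl := pmap _ s; set sr := pmap _ s.
have tk0 := @time_gt0 R k.
have R0 : 0 <= tc z ^+ 2 * time k by rewrite mulr_ge0 ?sqr_ge0// ltW.
have [zk|zk] := ltP (4 * tc z) (3 * time k).
  pose U := [set u : 'rV[R]_1 | u 0 ord0 < 3 / 4 * time k].
  have oU : open U.
    apply: (@open_comp _ _ (fun u : 'rV[R]_1 => u 0 ord0) [set x | x < 3 / 4 * time k]).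
      by move=> v _; exact: coord_continuous.
    exact: open_lt.
  rewrite (@partials_eq _ _ U _ (cst 0) _ _ oU); first last.
  - by rewrite /U /=; lra.
  - by move=> u Uu; apply: bump_at_before; rewrite /U /= in Uu; lra.
  by rewrite partials_cst0 mul0r normr0.
have sk : (size s <= k)%N.
  rewrite leqNgt; apply/negP => ks; have := @time_le R _ _ ks; rewrite timeS.
  by have := @time_gt0 R (size s); lra.
have [C0 CkP] := CP k.
have sz (T : Type) (f : 'I_(1 + m) -> option T) : (size (pmap f s) <= k)%N.
  by rewrite size_pmap (leq_trans (count_size _ _)).
rewrite normrM (le_trans (ler_pM _ _ (CkP sl (lsubmx z) (sz _ _)) (h_small (sz _ _) Wz)))//.
have -> : C k * (time k ^+ 3 / (4 * C k)) = (time k / 2) ^+ 2 * time k :> R.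
  by field; rewrite lt0r_neq0.
apply: ler_wpM2r; first exact: ltW.
by apply: lerXn2r; rewrite ?nnegrE; lra.
Qed.

Lemma bump_series_smooth : smooth_real W bump_series.
Proof.
apply: (@smooth_flat_extension _ _ _ W') => //.
- move=> s z [Wz /= z0].
  pose K := Num.bound (4 / tc z); pose U := W `&` [set z | 2 / K%:R < tc z].
  have zK : 4 / tc z < K%:R by apply: archi_boundP; rewrite divr_ge0// ltW.
  have K0 : 0 < K%:R :> R by apply: lt_trans zK; rewrite divr_gt0.
  have oU : open U by apply: openI => //; exact: open_tc_gt.
  apply: (@smooth_real_eq _ _ U (fun z => \sum_(k < K) term k z)) => //.
  + move=> y [Wy /= yK]; have y0 : 0 < tc y by apply: lt_trans yK; rewrite divr_gt0.
    by rewrite -bump_series_finite//; rewrite ltr_pdivrMr// mulrC -ltr_pdivrMr.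
  + apply: (@smooth_real_subset _ _ _ W) => [y []//|].
    exact: smooth_real_sum.
  split=> //=; rewrite ltr_pdivrMr//; move: zK; rewrite ltr_pdivrMr// mulrC; lra.
- move=> y Wy nW'y; apply: bump_series_le0; rewrite leNgt; apply/negP => y0.
  by apply: nW'y.
(* The constant 2 bounds the geometric sum of the [time k]; the time of [z0] being nonpositive,
   [tc z] is at most the distance from [z] to [z0]. *)
- move=> s z0 Wz0 nW'z0; exists 2.
  have z00 : tc z0 <= 0 by rewrite leNgt; apply/negP => ?; apply: nW'z0.
  have : 0 < time (size s) / 2 :> R by rewrite divr_gt0// time_gt0.
  move=> d0; have := nbhsx_ballx z0 _ d0; apply: filterS => z.
  rewrite -ball_normE /ball_/= distrC => zd W'z; have [Wz /= zgt0] := W'z.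
  have tz : tc z <= `|z - z0|.
    rewrite (le_trans _ (norm_coord_le _ (lshift m ord0)))// !mxE.
    rewrite (le_trans _ (ler_norm _))// lerBrDr gerDl.
    by move: z00; rewrite mxE.
  rewrite (@bump_series_partials (Num.bound (2 / tc z)))//; last first.
    by apply: archi_boundP; rewrite divr_ge0// ltW.
  rewrite (le_trans (ler_norm_sum _ _ _))//.
  apply: (@le_trans _ _ (\sum_(k < Num.bound (2 / tc z)) tc z ^+ 2 * time k)).
    by apply: ler_sum => k _; apply: term_bound => //; exact: le_lt_trans zd.
  rewrite -mulr_sumr mulrC ler_pM ?sqr_ge0 ?sumr_ge0//.
    by move=> k _; rewrite ltW// time_gt0.
  by apply: lerXn2r; rewrite ?nnegrE// ltW.
Qed.

End special_curve_real.

(** The order of quantifiers is the point: [eps] precedes the dimensions, the open set and the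
    sequence, so one speed suits all charts and the maps can be chosen to match it. *)
Lemma special_curve (R : realType) : exists eps : nat -> R, (forall k, 0 < eps k) /\
  forall m n (O : set 'rV[R]_m) (h : nat -> 'rV[R]_m -> 'rV[R]_n), open O ->
    (forall k, smooth_on O (h k)) ->
    (forall k s x, (size s <= k)%N -> O x -> `|iter_partial s (h k) x| <= eps k) ->
  exists G : 'rV[R]_(1 + m) -> 'rV[R]_n,
    [/\ smooth_on [set z | O (rsubmx z)] G,
        forall k x, G (row_mx (const_mx (time k)) x) = h k x &
        forall x, G (row_mx 0 x) = 0].
Proof.
have [C CP] := choice (@bump_bound R).
exists (fun k => time k ^+ 3 / (4 * C k)); split=> [k|m n O h oO hO h_small].
  by have [C0 _] := CP k; rewrite divr_gt0 ?mulr_gt0 ?exprn_gt0// time_gt0.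
exists (fun z => \row_j bump_series (fun k x => h k x 0 j) z); split.
- have oW : open [set z : 'rV[R]_(1 + m) | O (rsubmx z)].
    by apply: open_comp => // z _; exact: rsubmx_continuous.
  apply/(smooth_onP _ oW) => j; have hOj k := smooth_on_coord j oO (hO k).
  apply: (smooth_real_eq oW _ (bump_series_smooth CP oO hOj _)) => [y _|k s x sk Ox].
    by rewrite mxE.
  rewrite (le_trans _ (h_small k s x sk Ox))//.
  rewrite (iter_partial_smooth_on _ oO (hO k) Ox).
  by rewrite (le_trans _ (norm_coord_le _ j))// mxE.
- by move=> k x; apply/rowP => j; rewrite mxE bump_series_time.
- by move=> x; apply/rowP => j; rewrite !mxE bump_series_le0// row_mxKl mxE.
Qed.

(** * Smooth maps in charts *)

Lemma open_setI_preimage (S T : topologicalType) (A : set S) (B : set T) (f : S -> T) :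
  open A -> open B -> (forall x, A x -> {for x, continuous f}) -> open (A `&` f @^-1` B).
Proof.
move=> oA oB fA; rewrite openE => x [Ax Bfx].
apply: filterI; first exact: open_nbhs_nbhs.
by apply: (fA x Ax); exact: open_nbhs_nbhs.
Qed.

Section charts.
Context {R : realType} {T : topologicalType} {m : nat}.
Implicit Types (c d : chart R T m) (U : set T).

Lemma chart_image c U : U `<=` chart_dom c ->
  c @` U = (c @` chart_dom c) `&` (chart_inv c @^-1` U).
Proof.
move=> Uc; apply/seteqP; split=> [_ [x Ux <-]|y [[x cx <-]]].
  by split; [exists x => //; exact: Uc|rewrite /= chart_funK//; exact: Uc].
by rewrite /= chart_funK// => Ux; exists x.
Qed.

Lemma chart_image_open c U : open U -> U `<=` chart_dom c -> open (c @` U).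
Proof.
move=> oU Uc; rewrite chart_image//; apply: open_setI_preimage => //.
  exact: chart_codom_open.
by move=> y; exact: chart_inv_continuous.
Qed.

Lemma chart_invK c y : (c @` chart_dom c) y -> c (chart_inv c y) = y.
Proof. by case=> x cx <-; rewrite chart_funK. Qed.

Lemma chart_inv_dom c y : (c @` chart_dom c) y -> chart_dom c (chart_inv c y).
Proof. by case=> x cx <-; rewrite chart_funK. Qed.

End charts.

Lemma row_mx_smooth (R : realType) p a b (W : set 'rV[R]_p) (f : 'rV[R]_p -> 'rV[R]_a)
    (g : 'rV[R]_p -> 'rV[R]_b) : open W -> smooth_on W f -> smooth_on W g ->
  smooth_on W (fun x => row_mx (f x) (g x)).
Proof.
move=> oW fW gW; apply/(smooth_onP _ oW) => j; case: (fintype.split_ordP j) => i ->.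
  by apply: (smooth_real_eq oW _ (smooth_on_coord i oW fW)) => x _; rewrite row_mxEl.
by apply: (smooth_real_eq oW _ (smooth_on_coord i oW gW)) => x _; rewrite row_mxEr.
Qed.

Lemma smooth_on_cst (R : realType) p q (W : set 'rV[R]_p) (v : 'rV[R]_q) : open W ->
  smooth_on W (fun=> v).
Proof. by move=> oW; apply/(smooth_onP _ oW) => j; exact: smooth_real_cst. Qed.

Lemma smooth_on_id (R : realType) p (W : set 'rV[R]_p) : open W -> smooth_on W id.
Proof. by move=> oW; apply/(smooth_onP _ oW) => j; exact: smooth_real_coord. Qed.

Lemma smooth_onD (R : realType) p q (W : set 'rV[R]_p) (f g : 'rV[R]_p -> 'rV[R]_q) :
  open W -> smooth_on W f -> smooth_on W g -> smooth_on W (fun x => f x + g x).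
Proof.
move=> oW fW gW; apply/(smooth_onP _ oW) => j.
apply: (smooth_real_eq oW _ (smooth_realD oW (smooth_on_coord j oW fW) (smooth_on_coord j oW gW))).
by move=> x _; rewrite mxE.
Qed.

Lemma smooth_onZ (R : realType) p q (W : set 'rV[R]_p) (k : 'rV[R]_p -> R)
    (f : 'rV[R]_p -> 'rV[R]_q) :
  open W -> smooth_real W k -> smooth_on W f -> smooth_on W (fun x => k x *: f x).
Proof.
move=> oW kW fW; apply/(smooth_onP _ oW) => j.
apply: (smooth_real_eq oW _ (smooth_realM oW kW (smooth_on_coord j oW fW))).
by move=> x _; rewrite mxE.
Qed.

Lemma smooth_onB (R : realType) p q (W : set 'rV[R]_p) (f g : 'rV[R]_p -> 'rV[R]_q) :
  open W -> smooth_on W f -> smooth_on W g -> smooth_on W (fun x => f x - g x).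
Proof.
move=> oW fW gW; have H := smooth_onZ oW (@smooth_real_cst _ _ W (-1)) gW.
apply: (smooth_on_eq oW _ (smooth_onD oW fW H)) => x _.
by rewrite scaleN1r.
Qed.

Lemma row_mx_continuous (R : realType) p q :
  continuous (fun z : 'rV[R]_p * 'rV[R]_q => row_mx z.1 z.2).
Proof.
move=> z; apply: row_continuous => j; case: (fintype.split_ordP j) => i ->.
  rewrite (_ : (fun y : _ * _ => _) = (fun y : 'rV[R]_p * 'rV[R]_q => y.1 0 i)).
    apply: (@continuous_comp _ _ _ fst (fun u : 'rV[R]_p => u 0 i)); first exact: cvg_fst.
    exact: coord_continuous.
  by apply/funext => y; rewrite row_mxEl.
rewrite (_ : (fun y : _ * _ => _) = (fun y : 'rV[R]_p * 'rV[R]_q => y.2 0 i)).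
  apply: (@continuous_comp _ _ _ snd (fun u : 'rV[R]_q => u 0 i)); first exact: cvg_snd.
  exact: coord_continuous.
by apply/funext => y; rewrite row_mxEr.
Qed.

Section smooth_in_charts.
Context {R : realType} {S T : topologicalType} {p q : nat}.
Variables (A : set (chart R S p)) (B : set (chart R T q)).
Implicit Types (F : S -> T) (z : S).

(** Asks for one pair of charts around [z], whereas [smooth_in_charts] quantifies over all pairs. A
    glued map comes with exactly one natural pair at each point, so this is the form that can be
    checked. *)
Definition represented_at F z := exists (a : chart R S p) (b : chart R T q)
    (O : set 'rV[R]_p) (g : 'rV[R]_p -> 'rV[R]_q),
  [/\ A a /\ B b, chart_dom a z, open O /\ O (a z), smooth_on O g &
      forall y, O y -> [/\ (a @` chart_dom a) y, chart_dom b (F (chart_inv a y)) &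
                           b (F (chart_inv a y)) = g y]].

Lemma represented_at_eq F F' z (V : set S) : open V -> V z ->
  (forall x, V x -> F x = F' x) -> represented_at F z -> represented_at F' z.
Proof.
move=> oV Vz FF' [a [b [ O [g [AB az [ oO Oz] gO Og]]]]].
have oO' : open (O `&` a @` (chart_dom a `&` V)).
  apply: openI => //; apply: chart_image_open; last by move=> ? [].
  by apply: openI => //; exact: chart_dom_open.
exists a, b, (O `&` a @` (chart_dom a `&` V)), g; split=> //.
- by split=> //; split=> //; exists z.
- by apply: smooth_on_subset gO => y [].
- move=> y [Oy [x [ax Vx] xy]]; have [H1 H2 H3] := Og y Oy.
  have Vy : V (chart_inv a y) by rewrite -xy chart_funK.
  by rewrite -FF'.
Qed.

Lemma represented_at_continuous F z : represented_at F z -> {for z, continuous F}.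
Proof.
case=> a [b [ O [g [_ az [ oO Oz] gO Og]]]].
have [_ bF E] := Og _ Oz.
have c1 : {for z, continuous (chart_inv b \o (g \o a))}.
  apply: continuous_comp.
    apply: continuous_comp; first exact: chart_fun_continuous.
    exact: smooth_on_continuous gO Oz.
  apply: chart_inv_continuous; exists (F (chart_inv a (a z))) => //.
have nE : \forall x \near z, (chart_inv b \o (g \o a)) x = F x.
  have n1 := open_nbhs_nbhs (conj (chart_dom_open a) az).
  have n2 : nbhs z (a @^-1` O).
    by apply: (chart_fun_continuous az); exact: open_nbhs_nbhs.
  apply: filterS (filterI n1 n2) => x [ax Ox]; have [_] := Og _ Ox.
  by rewrite chart_funK//= => bx <-; rewrite chart_funK.
move: c1; rewrite /prop_for /continuous_at (nbhs_singleton nE) => c1.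
exact: cvg_trans (near_eq_cvg nE) c1.
Qed.

Hypothesis compatA : forall a a', A a -> A a' -> chart_compatible a a'.
Hypothesis compatB : forall b b', B b -> B b' -> chart_compatible b b'.

(* Near a point, the expression of F in other charts is the composite of the
   given one with the changes of charts. *)
Lemma represented_smooth_in_charts F (W : set S) :
  (forall z, W z -> represented_at F z) -> smooth_in_charts A B W F.
Proof.
move=> FW; split=> [z /FW|a0 b0 Aa0 Bb0]; first exact: represented_at_continuous.
apply: smooth_on_local => _ [z [[a0z Wz] b0Fz] <-].
have [a [b [ O [g [[Aa Bb] az [ oO Oz] gO Og]]]]] := FW z Wz.
pose D := a0 @` (chart_dom a0 `&` chart_dom a).
have oD : open D.
  apply: chart_image_open; last by move=> ? [].
  by apply: openI; exact: chart_dom_open.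
pose E := b @` (chart_dom b `&` chart_dom b0).
have oE : open E.
  apply: chart_image_open; last by move=> ? [].
  by apply: openI; exact: chart_dom_open.
have [sa _] := compatA Aa0 Aa; have [sb _] := compatB Bb Bb0.
pose D1 := D `&` (a \o chart_inv a0) @^-1` O.
have oD1 : open D1.
  by apply: (open_setI_preimage oD oO) => y Dy; exact: smooth_on_continuous sa Dy.
have s1 : smooth_on D1 (g \o (a \o chart_inv a0)).
  apply: (@smooth_on_comp _ _ _ _ D1 O) => //; first by move=> y [].
  by apply: smooth_on_subset sa => y [].
pose D2 := D1 `&` (g \o (a \o chart_inv a0)) @^-1` E.
have oD2 : open D2.
  by apply: (open_setI_preimage oD1 oE) => y Dy; exact: smooth_on_continuous s1 Dy.
have FE x : chart_dom a x -> O (a x) -> chart_dom b (F x) /\ b (F x) = g (a x).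
  by move=> ax /Og[_]; rewrite chart_funK.
exists D2.
  split; first split.
  - by exists z.
  - by rewrite /= chart_funK.
  - rewrite /= chart_funK//; have [bF <-] := FE z az Oz.
    by exists (F z).
have s2 : smooth_on D2 ((b0 \o chart_inv b) \o (g \o (a \o chart_inv a0))).
  apply: (@smooth_on_comp _ _ _ _ D2 E) => //; first by move=> y [].
  by apply: smooth_on_subset s1 => y [].
apply: smooth_on_eq s2 => // y [[[x [a0x ax] <-] /=]]; rewrite chart_funK// => Ox _.
by have [bF <-] := FE x ax Ox; rewrite chart_funK.
Qed.

Lemma smooth_in_charts_open F (W : set S) (a : chart R S p) (b : chart R T q) : open W ->
  smooth_in_charts A B W F -> open (a @` (chart_dom a `&` W `&` F @^-1` chart_dom b)).
Proof.
move=> oW [cF _]; apply: chart_image_open; last by move=> ? [[]].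
apply: open_setI_preimage; [|exact: chart_dom_open|by move=> x [_ /cF]].
by apply: openI => //; exact: chart_dom_open.
Qed.

End smooth_in_charts.

Section product_manifold.
Context {R : realType} {m : nat} (M : manifold R m) (k : nat).

Lemma product_chart_compatible (c c' : chart R M m) : chart_compatible c c' ->
  chart_compatible (product_chart (euclidean_chart R k) c)
                   (product_chart (euclidean_chart R k) c').
Proof.
have key (e e' : chart R M m) :
   smooth_on (e @` (chart_dom e `&` chart_dom e')) (e' \o chart_inv e) ->
   smooth_on (product_chart (euclidean_chart R k) e @`
     (chart_dom (product_chart (euclidean_chart R k) e) `&`
      chart_dom (product_chart (euclidean_chart R k) e')))
     (product_chart (euclidean_chart R k) e' \o
        chart_inv (product_chart (euclidean_chart R k) e)).
  move=> s; pose D := [set y : 'rV[R]_(k + m) | (e @` (chart_dom e `&` chart_dom e')) (rsubmx y)].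
  have oD : open D.
    apply: open_comp; first by move=> y _; exact: rsubmx_continuous.
    apply: chart_image_open; last by move=> ? [].
    by apply: openI; exact: chart_dom_open.
  apply: (@smooth_on_subset _ _ _ _ D) => [_ [z [[_ ez] [_ e'z]] <-]|].
    by rewrite /D /= row_mxKr; exists z.2.
  apply: (row_mx_smooth oD); first exact: lsubmx_smooth.
  apply: (@smooth_on_comp _ _ _ _ D (e @` (chart_dom e `&` chart_dom e'))
            (@rsubmx R 1 k m) (e' \o chart_inv e)) => //.
    apply: chart_image_open; last by move=> ? [].
    by apply: openI; exact: chart_dom_open.
  exact: rsubmx_smooth.
move=> [s1 s2]; split; first exact: key.
by rewrite setIC; apply: key; rewrite setIC.
Qed.

Lemma euclidean_product_atlas_compatible a a' :
  @euclidean_product_atlas R m M k a -> @euclidean_product_atlas R m M k a' ->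
  chart_compatible a a'.
Proof.
move=> [c cM <-] [c' c'M <-]; apply: product_chart_compatible.
exact: atlas_compatible.
Qed.

End product_manifold.

Section slice_of_smooth.
Context {R : realType} {m n k : nat} (M : manifold R m) (N : manifold R n).

Lemma represented_at_slice (F : 'rV[R]_k * M -> N) t x :
  represented_at (@euclidean_product_atlas R m M k) (@atlas R n N) F (t, x) ->
  represented_at (@atlas R m M) (@atlas R n N) (fun x => F (t, x)) x.
Proof.
move=> [_ [d [ O [g [[[c cM <-] dN] [_ /= cx] [ oO Oz] gO Og]]]]].
have sr (W : set 'rV[R]_m) : open W -> smooth_on W (fun y => row_mx t y).
  by move=> oW; exact: (row_mx_smooth oW (smooth_on_cst _ oW) (smooth_on_id oW)).
have oO' : open [set y | O (row_mx t y)].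
  apply: open_comp => // y _; exact: (smooth_on_continuous (sr setT openT)).
exists c, d, [set y | O (row_mx t y)], (fun y => g (row_mx t y)); split=> //.
  by apply: (@smooth_on_comp _ _ _ _ _ O (row_mx t) g) => //; exact: sr.
move=> y /Og[]; rewrite /= row_mxKl row_mxKr => -[z [_ /= cz] E].
have {E} [_ zy] := eq_row_mx E.
by move=> H1 H2; split=> //; exists z.2.
Qed.

End slice_of_smooth.

(** * Weakly open sets are D-open *)

Lemma continuous_pair (S T U : topologicalType) (f : S -> T) (g : S -> U) x :
  {for x, continuous f} -> {for x, continuous g} -> {for x, continuous (fun z => (f z, g z))}.
Proof. by move=> cf cg; exact: (cvg_pair cf cg). Qed.

Section multi_indices.
Context {R : realType} {p q : nat}.
Implicit Types (s : seq 'I_p) (a : 'I_p -> nat).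

Lemma size_multi_index a :
  size (flatten [seq nseq (a j) j | j <- enum 'I_p]) = multi_index_order a.
Proof.
rewrite size_flatten /shape -map_comp sumnE big_map /multi_index_order big_enum /=.
by apply: eq_bigr => j _; rewrite /= size_nseq.
Qed.

Lemma perm_multi_index s :
  perm_eq s (flatten [seq nseq (count_mem j s) j | j <- enum 'I_p]).
Proof.
apply/allP => x _ /=; apply/eqP.
rewrite count_flatten -map_comp sumnE big_map big_enum /= (bigD1 x)//=.
rewrite count_nseq /= eqxx mul1n big1 ?addn0// => j jx.
by rewrite count_nseq /= (negbTE jx) mul0n.
Qed.

Lemma iter_partial_multi W (f : 'rV[R]_p -> 'rV[R]_q) s x : open W -> smooth_on W f -> W x ->
  iter_partial s f x = multi_partial (fun j => count_mem j s) f x.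
Proof.
move=> oW fW Wx; rewrite /multi_partial !(iter_partial_smooth_on _ oW fW Wx).
apply/rowP => j; rewrite !mxE.
exact: (partials_perm oW (smooth_on_coord j oW fW) (perm_multi_index s) Wx).
Qed.

End multi_indices.

(** Turns the derivatives of a single map of a plot into derivatives of the joint expression, whose
    continuity in parameter and point together is what compactness is applied to. *)
Lemma iter_partial_slice (R : realType) p q k (g : 'rV[R]_(p + q) -> 'rV[R]_k) s x y :
  iter_partial s (fun y => g (row_mx x y)) y =
  iter_partial (map (@rshift p q) s) g (row_mx x y).
Proof.
elim: s y => [//|i s IH] y /=.
by apply: derive_transport => h; rewrite IH row_mx_delta_r.
Qed.

Section weak_topology.
Context {R : realType} {m n : nat} {M : manifold R m} {N : manifold R n}.

Lemma weak_subbasis_open (A : set (smooth_map M N)) :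
  weak_subbasis A -> smooth_map_weak_topology M N A.
Proof.
move=> bA; exists [set A]; last by rewrite bigcup_set1.
by move=> _ ->; exact: (@finI_from1 _ _ (@weak_subbasis R m n M N) id A bA).
Qed.

Lemma D_open_bigcap_fset (E : {fset set (smooth_map M N)}) :
  (forall A, A \in E -> D_open A) -> D_open (\bigcap_(A in [set` E]) A).
Proof.
move=> ED; rewrite bigcap_fset big_seq.
elim/big_rec: _ => [|S T SE DT]; first exact: D_openT.
by apply: D_openI => //; exact: ED.
Qed.

Lemma weak_open_D_open : (forall A, @weak_subbasis R m n M N A -> D_open A) ->
  smooth_map_weak_topology M N `<=` smooth_map_D_topology M N.
Proof.
move=> subD _ [D DfinI <-]; apply: (@bigcup_open (D_smooth_map M N)) => B /DfinI[E Esub <-].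
by apply: D_open_bigcap_fset => A /Esub/set_mem; exact: subD.
Qed.

(** Lists of bounded length over the finite type ['I_m] form a finite type, and a filter is stable
    under finite intersections. *)
Lemma near_all_size r (T : Type) (F : set_system T) (P : seq 'I_m -> T -> Prop) : Filter F ->
  (forall s, (size s <= r)%N -> \forall x \near F, P s x) ->
  \forall x \near F, forall s, (size s <= r)%N -> P s x.
Proof.
move=> FF FP.
have := @filter_forall _ (r.-bseq 'I_m) (fun s x => P s x) F FF (fun s => FP s (size_bseq s)).
by apply: filterS => x Px s sr; exact: (Px (Bseq sr)).
Qed.

Lemma weak_nbhd_D_open r (f : smooth_map M N) c d (K : set M) e :
  atlas c -> atlas d -> K `<=` chart_dom c -> compact K -> f @` K `<=` chart_dom d ->
  D_open (weak_nbhd r f c d K e).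
Proof.
move=> cM dN Kc cK fK k U p oU pU; rewrite openE => u0 [Uu0 [pK pe]].
pose P1 := product_chart (euclidean_chart R k) c.
pose F (z : 'rV[R]_k * M) : N := p z.1 z.2.
have P1A : @euclidean_product_atlas R m M k P1 by exists c.
have oUT : open (U `*` [set: M]).
  rewrite openE => z [Uz _]; exists (U, setT) => //=.
  by split; [exact: open_nbhs_nbhs|exact: filterT].
pose Om := P1 @` (chart_dom P1 `&` (U `*` [set: M]) `&` F @^-1` chart_dom d).
have oOm : open Om := @smooth_in_charts_open _ _ _ _ _ _ _ F _ P1 d oUT pU.
pose Phi := d \o F \o chart_inv P1.
have sPhi : smooth_on Om Phi := pU.2 P1 d P1A dN.
pose fl := d \o f \o chart_inv c.
pose Of := c @` (chart_dom c `&` setT `&` f @^-1` chart_dom d).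
have oOf : open Of := @smooth_in_charts_open _ _ _ _ _ _ _ f _ c d openT (smooth_mapP f).
have sf : smooth_on Of fl := (smooth_mapP f).2 c d cM dN.
have PhiE u : d \o p u \o chart_inv c = fun y => Phi (row_mx u y).
  by apply/funext => y; rewrite /Phi /F /= row_mxKl row_mxKr.
pose Q u x := chart_dom d (p u x) /\ forall s, (size s <= r)%N ->
  `|iter_partial s fl (c x) - iter_partial (map (@rshift k m) s) Phi (row_mx u (c x))| < e.
(* The tube lemma: a condition that holds near [(u0, x)] for every [x] in the compact [K] holds on
   all of [K] for [u] near [u0]. *)
have : \forall u \near nbhs u0, K `<=` Q u.
  apply: ((compact_near_coveringP K).1 cK _ (nbhs u0) Q _) => x Kx.
  have dpx : chart_dom d (p u0 x) by apply: pK; exists x.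
  have Omx : Om (row_mx u0 (c x)).
    by exists (u0, x) => //; split=> //; split=> //; split=> //; exact: Kc.
  have Ofx : Of (c x).
    by exists x => //; split; [split=> //; exact: Kc|apply: fK; exists x].
  have cc : {for x, continuous c} := chart_fun_continuous (Kc _ Kx).
  apply: filterI.
    have cF : {for (u0, x), continuous F} := pU.1 (u0, x) (conj Uu0 I).
    have H : nbhs (u0, x) (F @^-1` chart_dom d).
      by apply: cF; apply: open_nbhs_nbhs; split=> //; exact: chart_dom_open.
    have sw : {for (x, u0), continuous (fun z : M * 'rV[R]_k => (z.2, z.1))}.
      by apply: continuous_pair; [exact: cvg_snd|exact: cvg_fst].
    exact: (sw _ H).
  pose D s (z : M * 'rV[R]_k) := iter_partial s fl (c z.1) -
     iter_partial (map (@rshift k m) s) Phi (row_mx z.2 (c z.1)).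
  apply: (@near_all_size r _ (nbhs (x, u0)) (fun s z => `|D s z| < e)) => s sr.
  have cc1 : {for (x, u0), continuous (fun z : M * 'rV[R]_k => c z.1)}.
    by apply: (@continuous_comp _ _ _ fst c); [exact: cvg_fst|].
  have cD : {for (x, u0), continuous (D s)}.
    apply: continuousB.
      apply: (@continuous_comp _ _ _ (fun z : M * 'rV[R]_k => c z.1)) => //.
      exact: (sf s _ Ofx).1.
    apply: (@continuous_comp _ _ _ (fun z : M * 'rV[R]_k => row_mx z.2 (c z.1))).
      apply: (@continuous_comp _ _ _ (fun z : M * 'rV[R]_k => (z.2, c z.1))
         (fun z => row_mx z.1 z.2)); last exact: row_mx_continuous.
      by apply: continuous_pair; [exact: cvg_snd|exact: cc1].
    exact: (sPhi (map (@rshift k m) s) _ Omx).1.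
  have D0 : `|D s (x, u0)| < e.
    rewrite /D /= -iter_partial_slice -PhiE.
    have sr' (W : set 'rV[R]_m) : open W -> smooth_on W (row_mx u0).
      by move=> oW; exact: (row_mx_smooth oW (smooth_on_cst _ oW) (smooth_on_id oW)).
    have oV : open [set y | Om (row_mx u0 y)].
      by apply: open_comp => // y _; exact: (smooth_on_continuous (sr' setT openT)).
    have sp : smooth_on [set y | Om (row_mx u0 y)] (d \o p u0 \o chart_inv c).
      by rewrite PhiE; apply: (@smooth_on_comp _ _ _ _ _ Om (row_mx u0) Phi) => //; exact: sr'.
    (* Membership of [p u0] is known only for derivatives in multi-index order, so the list [s] is
       first sorted on both sides. *)
    rewrite (iter_partial_multi _ oOf sf Ofx) (iter_partial_multi _ oV sp Omx).
    apply: pe; first by exists x.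
    by rewrite -size_multi_index -(perm_size (perm_multi_index s)).
  have cnD : {for (x, u0), continuous (fun z => `|D s z|)}.
    by apply: (@continuous_comp _ _ _ (D s) (fun v => `|v|)) => //; exact: norm_continuous.
  have H : nbhs (`|D s (x, u0)| : R) [set v : R | v < e].
    by apply: open_nbhs_nbhs; split; [exact: open_lt|exact: D0].
  exact: cnD _ H.
have : nbhs u0 U by exact: open_nbhs_nbhs.
apply: filterS2 => u Uu uQ; split=> //; split=> [_ [x Kx <-]|_ [x Kx <-] a ar].
  by have [] := uQ x Kx.
have [_ /(_ (flatten [seq nseq (a j) j | j <- enum 'I_m]))] := uQ x Kx.
by rewrite size_multi_index => /(_ ar); rewrite -iter_partial_slice -PhiE.
Qed.

Lemma weak_sub_D : smooth_map_weak_topology M N `<=` smooth_map_D_topology M N.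
Proof.
apply: weak_open_D_open => _ [r [f [c [d [K [e [[cM dN] [Kc cK] fK _ ->]]]]]]].
exact: weak_nbhd_D_open.
Qed.

End weak_topology.

(** * D-open sets are weakly open *)

Section cutoff.
Context {R : realType} {m : nat}.
Variables (a : 'rV[R]_m) (r : R).
Hypothesis r0 : 0 < r.

(** The norm on rows is the sup norm, so a product of one-variable plateaus is adapted to its balls,
    and it is smooth although the norm is not. *)
Definition cutoff (y : 'rV[R]_m) : R := \prod_(i < m) plateau ((y 0 i - a 0 i) / r).

Lemma cutoff1 y : `|y - a| <= r -> cutoff y = 1.
Proof.
move=> ya; rewrite /cutoff big1// => i _; apply: plateau1.
rewrite normrM normfV (gtr0_norm r0) ler_pdivrMr// mul1r (le_trans _ ya)//.
by rewrite (le_trans _ (norm_coord_le _ i))// !mxE.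
Qed.

Lemma cutoff0 y : 2 * r <= `|y - a| -> cutoff y = 0.
Proof.
move=> ya; suff [i yi] : exists i, 2 * r <= `|y 0 i - a 0 i|.
  rewrite /cutoff (bigD1 i)//= plateau0 ?mul0r//.
  by rewrite normrM normfV (gtr0_norm r0) ler_pdivlMr.
apply: contrapT => /forallNP H; move: ya; apply/negP; rewrite -ltNge.
apply: norm_row_lt => [|i]; first by rewrite mulr_gt0.
by rewrite !mxE ltNge; apply/negP; exact: H.
Qed.

Lemma smooth_cutoff : smooth_real setT cutoff.
Proof.
apply: (smooth_real_prod _ openT) => i.
apply: (smooth1_comp openT smooth_plateau); apply: (smooth_realM openT).
  apply: (smooth_realB openT); last exact: smooth_real_cst.
  exact: smooth_real_coord openT.
exact: smooth_real_cst.
Qed.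

End cutoff.

Lemma norm_sub_continuous (R : realType) (T : topologicalType) p (f : T -> 'rV[R]_p) a :
  continuous f -> continuous (fun y => `|f y - a|).
Proof.
move=> cf y; apply: (@continuous_comp _ _ _ f (fun v : 'rV[R]_p => `|v - a|)).
  exact: cf.
apply: (@continuous_comp _ _ _ (fun v : 'rV[R]_p => v - a) (fun v : 'rV[R]_p => `|v|)).
  by apply: (@continuousB _ _ _ id (cst a)); [exact: cvg_id|exact: cst_continuous].
exact: norm_continuous.
Qed.

Lemma closed_ball_compact (R : realType) p (a : 'rV[R]_p) (e : R) :
  compact [set y | `|y - a| <= e].
Proof.
apply: bounded_closed_compact.
  exists (`|a| + e); split; rewrite ?num_real// => x ax y /= ye.
  rewrite -[y](subrK a) (le_trans (ler_normD _ _))// addrC.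
  by rewrite (le_trans (lerD (lexx _) ye))// ltW.
apply: (@closed_comp _ _ (fun y : 'rV[R]_p => `|y - a|) [set x | x <= e]); last exact: closed_le.
by move=> y _; apply: (@norm_sub_continuous _ _ _ id) => z; exact: cvg_id.
Qed.

(** * Gluing a local curve into a given one *)

Section gluing.
Context {R : realType} {m n : nat} {M : manifold R m} {N : manifold R n}.
Variables (f : smooth_map M N) (g : nat -> smooth_map M N).

Local Notation represented := (represented_at (@euclidean_product_atlas R m M 1) (@atlas R n N)).

(* A germ at t = 0 of a smooth curve t |-> F (t, .) from f, that takes at time
   2^-k the value of g k on X. *)
Definition curve_on (X : set M) (F : 'rV[R]_1 * M -> N) (U : set 'rV[R]_1) :=
  [/\ open U /\ U 0, forall z, U z.1 -> represented F z, forall x, F (0, x) = f x &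
      forall k x, X x -> F (const_mx (time k), x) = g k x].

Variables (c : chart R M m) (d : chart R N n) (a : 'rV[R]_m) (r : R).
Hypothesis cM : atlas c.
Hypothesis dN : atlas d.
Hypothesis r0 : 0 < r.
Let ball3 := [set y : 'rV[R]_m | `|y - a| < 3 * r].
Hypothesis cball : ball3 `<=` c @` chart_dom c.
Hypothesis fball : forall y, ball3 y -> chart_dom d (f (chart_inv c y)).
Hypothesis gball : forall k y, ball3 y -> chart_dom d (g k (chart_inv c y)).

Variable G : 'rV[R]_(1 + m) -> 'rV[R]_n.
Hypothesis sG : smooth_on [set w | ball3 (rsubmx w)] G.
Hypothesis G0 : forall y, ball3 y -> G (row_mx 0 y) = d (f (chart_inv c y)).
Hypothesis Gtime : forall k y, ball3 y ->
  G (row_mx (const_mx (time k)) y) = d (g k (chart_inv c y)).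

(* Only meaningful for small t, when F and mix stay in the domain of the chart d. *)
Let mix F (w : 'rV[R]_(1 + m)) : 'rV[R]_n :=
  let Phi := d (F (lsubmx w, chart_inv c (rsubmx w))) in
  Phi + cutoff a r (rsubmx w) *: (G w - Phi).

(** Three nested radii: the cutoff is 1 up to [r] and 0 from [2 * r] on, while the chart expressions
    are valid up to [3 * r], which leaves an open margin around the closed ball of radius
    [2 * r]. *)
Let inner := [set x | chart_dom c x /\ `|c x - a| < 2 * r].

Let glue F (z : 'rV[R]_1 * M) : N :=
  if `[< inner z.2 >] then chart_inv d (mix F (row_mx z.1 (c z.2))) else F z.

Let glue0 F x : (forall x, F (0, x) = f x) -> glue F (0, x) = f x.
Proof.
move=> F0; rewrite /glue; case: asboolP => // -[/= cx xa].
have b3 : ball3 (c x) by apply: (lt_trans xa); rewrite ltr_pM2r ?ltr_nat.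
rewrite /mix row_mxKl row_mxKr /= chart_funK// F0 G0// chart_funK// subrr scaler0 addr0.
by rewrite chart_funK//; have := fball b3; rewrite chart_funK.
Qed.

(** In the chart, either [F] and the local curve both take the value [g k x], so the correction is 0
    whatever the cutoff, or the cutoff is 1 and only the local curve remains. Only values matter
    here, so the time may lie outside the domain where the curve is smooth. *)
Let glue_time F k x :
  F (const_mx (time k), x) = g k x \/ (chart_dom c x /\ `|c x - a| < r) ->
  glue F (const_mx (time k), x) = g k x.
Proof.
move=> H; rewrite /glue; case: asboolP => [[/= cx xa]|/= nx].
  have b3 : ball3 (c x) by apply: (lt_trans xa); rewrite ltr_pM2r ?ltr_nat.
  have dg : chart_dom d (g k x) by have := gball k b3; rewrite chart_funK.
  rewrite /mix row_mxKl row_mxKr /= chart_funK// Gtime// chart_funK//.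
  case: H => [->|[_ xr]].
    by rewrite subrr scaler0 addr0 chart_funK.
  by rewrite cutoff1 ?ltW// scale1r addrCA subrr addr0 chart_funK.
case: H => // -[cx xr]; exfalso; apply: nx; split=> //.
by apply: (lt_trans xr); rewrite ltr_pMl ?ltr1n.
Qed.

(** The danger is that [F] or [mix F] leaves the chart [d]. At time 0 both are [f] read in the
    charts, so near time 0 neither does over the compact ball of radius [2 * r]; the new time domain
    is cut down accordingly. *)
Lemma curve_on_extend X F U : curve_on X F U ->
  exists F' U', curve_on (X `|` [set x | chart_dom c x /\ `|c x - a| < r]) F' U'.
Proof.
move=> [[oU U0] Frep F0 Ftime].
pose P1 := product_chart (euclidean_chart R 1) c.
have P1A : @euclidean_product_atlas R m M 1 P1 by exists c.
have oUT : open (U `*` [set: M]).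
  rewrite openE => z [Uz _]; exists (U, setT) => //=.
  by split; [exact: open_nbhs_nbhs|exact: filterT].
have sF : smooth_in_charts (@euclidean_product_atlas R m M 1) (@atlas R n N) (U `*` setT) F.
  apply: represented_smooth_in_charts.
  - exact: euclidean_product_atlas_compatible.
  - exact: atlas_compatible.
  - by move=> z [Uz _]; exact: Frep.
pose Om0 := P1 @` (chart_dom P1 `&` (U `*` [set: M]) `&` F @^-1` chart_dom d).
have oOm0 : open Om0 := @smooth_in_charts_open _ _ _ _ _ _ _ F _ P1 d oUT sF.
have oB3 : open [set w : 'rV[R]_(1 + m) | ball3 (rsubmx w)].
  apply: (@open_comp _ _ (fun w : 'rV[R]_(1 + m) => `|rsubmx w - a|) [set x | x < 3 * r]).
    by move=> w _; apply: norm_sub_continuous; exact: rsubmx_continuous.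
  exact: open_lt.
pose Om1 := Om0 `&` [set w | ball3 (rsubmx w)].
have oOm1 : open Om1 by exact: openI.
have smix : smooth_on Om1 (mix F).
  have s1 : smooth_on Om1 (fun w => d (F (lsubmx w, chart_inv c (rsubmx w)))).
    by apply: smooth_on_subset (sF.2 P1 d P1A dN) => w [].
  apply: (smooth_onD oOm1 s1); apply: (smooth_onZ oOm1).
    apply: (@smooth_real_comp _ _ _ Om1 setT (@rsubmx R 1 1 m) (cutoff a r));
      [exact: oOm1|by []| |].
      exact: rsubmx_smooth.
    exact: smooth_cutoff.
  apply: (smooth_onB oOm1); last exact: s1.
  by apply: smooth_on_subset sG => w [].
pose Om := Om1 `&` mix F @^-1` (d @` chart_dom d).
have oOm : open Om.
  apply: open_setI_preimage; [exact: oOm1|exact: chart_codom_open|] => w.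
  exact: smooth_on_continuous smix.
have OmE w : Om w -> [/\ ball3 (rsubmx w), U (lsubmx w),
    chart_dom d (F (lsubmx w, chart_inv c (rsubmx w))) & (d @` chart_dom d) (mix F w)].
  move=> [[[z [[[_ cz] [Uz _]] dz] <-] b3] mw]; split=> //.
    by rewrite /= row_mxKl.
  by rewrite /= row_mxKl row_mxKr chart_funK// -surjective_pairing.
have OmI t y : U t -> ball3 y -> chart_dom d (F (t, chart_inv c y)) ->
    (d @` chart_dom d) (mix F (row_mx t y)) -> Om (row_mx t y).
  move=> Ut b3 dF mw; split=> //; split; last by rewrite /= row_mxKr.
  have [x cx xy] := cball b3.
  exists (t, x); last by rewrite /= xy.
  by split=> //; rewrite /preimage /= -(chart_funK cx) xy.
pose K := [set y : 'rV[R]_m | `|y - a| <= 2 * r].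
have KB : K `<=` ball3 by move=> y ya; apply: (le_lt_trans ya); rewrite ltr_pM2r ?ltr_nat.
(* Tube lemma over the closed ball, starting from the slice at time 0. *)
have tube : nbhs (0 : 'rV[R]_1) (fun t : 'rV[R]_1 => K `<=` (fun y => Om (row_mx t y))).
  apply: ((compact_near_coveringP K).1 (@closed_ball_compact R m a (2 * r)) _
            (nbhs (0 : 'rV[R]_1)) (fun (t : 'rV[R]_1) y => Om (row_mx t y)) _) => y Ky.
  have b3 := KB _ Ky.
  have Om0y : Om (row_mx 0 y).
    apply: OmI => //; first by rewrite F0; exact: fball.
    rewrite /mix row_mxKl row_mxKr F0 G0// subrr scaler0 addr0.
    by exists (f (chart_inv c y)) => //; exact: fball.
  have cs : {for (y, (0 : 'rV[R]_1)), continuous (fun z : 'rV[R]_m * 'rV[R]_1 => row_mx z.2 z.1)}.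
    apply: (@continuous_comp _ _ _ (fun z : 'rV[R]_m * 'rV[R]_1 => (z.2, z.1))
      (fun z => row_mx z.1 z.2)); last exact: row_mx_continuous.
    by apply: continuous_pair; [exact: cvg_snd|exact: cvg_fst].
  by apply: (cs Om); exact: open_nbhs_nbhs.
have [V [oV V0] VK] : exists2 V : set 'rV[R]_1, open V /\ V 0 &
    forall t y, V t -> K y -> Om (row_mx t y).
  have := tube; rewrite nbhsE => -[V [oV V0] VK].
  by exists V => // t y /VK; exact.
pose U' := U `&` V.
have oU' : open U' by exact: openI.
(* Compact in a Hausdorff space, hence closed in all of [M]. Its complement is an open set on which
   [glue F] is [F], so the pasted curve stays smooth beyond the chart. *)
have cK : closed (chart_inv c @` K).
  apply: compact_closed; first exact: manifold_hausdorff.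
  apply: continuous_compact; last exact: closed_ball_compact.
  apply: continuous_in_subspaceT => y /set_mem Ky.
  by apply: chart_inv_continuous; apply: cball; exact: KB.
exists (glue F), U'; split=> //.
- move=> [t x] [/= Ut Vt].
  have [[y Ky yx]|nKx] := pselect ((chart_inv c @` K) x); last first.
    apply: (@represented_at_eq _ _ _ _ _ _ _ F _ _ (setT `*` ~` (chart_inv c @` K))).
    - rewrite openE => z [_ nz]; exists (setT, ~` (chart_inv c @` K)) => //=.
      split; first exact: filterT.
      by apply: open_nbhs_nbhs; split=> //; exact: closed_openC.
    - by split.
    - move=> [t' x'] [_ /= nx']; rewrite /glue; case: asboolP => // -[/= cx' xa'].
      exfalso; apply: nx'; exists (c x'); last exact: chart_funK.
      by rewrite /K /= ltW.
    - exact: Frep.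
  have Omw := VK _ _ Vt Ky.
  have cx : chart_dom c x by rewrite -yx; apply: chart_inv_dom; apply: cball; exact: KB.
  have cxy : c x = y by rewrite -yx chart_invK//; apply: cball; exact: KB.
  exists P1, d, Om, (mix F); split=> //.
  + by split=> //=; rewrite cxy.
  + by apply: smooth_on_subset smix => w [].
  + move=> w Ow; have [b3 Uw dF mw] := OmE w Ow.
    have [x' cx' xw] := cball b3.
    split.
    * by exists (lsubmx w, x') => //=; rewrite xw hsubmxK.
    * rewrite /= /glue; case: asboolP => //= -[_ _].
      rewrite -xw chart_funK// xw hsubmxK; exact: chart_inv_dom.
    * rewrite /= /glue; case: asboolP => /= [_|nin].
        by rewrite -xw chart_funK// xw hsubmxK chart_invK.
      (* In the shell beyond radius [2 * r] the cutoff vanishes, so [mix F] is just [F] in the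
         charts: the two branches of [glue] have the same expression on all of [Om]. *)
      rewrite /mix cutoff0 ?scale0r ?addr0// leNgt; apply/negP => wa; apply: nin.
      by rewrite /inner /= -xw chart_funK// xw.
- by move=> x; exact: glue0.
- move=> k x [Xx|cx]; apply: glue_time; last by right.
  by left; exact: Ftime.
Qed.

End gluing.

Lemma iter_partialB (R : realType) p q (W : set 'rV[R]_p) (f g : 'rV[R]_p -> 'rV[R]_q) s x :
  open W -> smooth_on W f -> smooth_on W g -> W x ->
  iter_partial s (fun y => f y - g y) x = iter_partial s f x - iter_partial s g x.
Proof.
move=> oW fW gW; elim: s x => [//|i s IH] x Wx.
have nE : \forall y \near x,
    iter_partial s (fun y => f y - g y) y = iter_partial s f y - iter_partial s g y.
  by have := open_nbhs_nbhs (conj oW Wx); apply: filterS.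
rewrite [LHS](near_eq_derive _ nE) deriveB//; first exact: (fW s x Wx).2.
exact: (gW s x Wx).2.
Qed.

(* [compact_cover] only applies to pointed spaces. *)
Lemma compact_finite_cover (T : topologicalType) (K : set T) (V : T -> set T) : compact K ->
  (forall x, K x -> nbhs x (V x)) -> exists L : seq T, forall x, K x -> exists2 p, p \in L & V p x.
Proof.
move=> /compact_near_coveringP cK KV.
(* The filter of properties that hold for all sufficiently large finite lists; near-covering along
   it produces a finite subcover. *)
pose F := [set S : set (seq T) | exists L0 : seq T, forall L, {subset L0 <= L} -> S L].
have FF : Filter F.
  split; first by exists [::].
    move=> S1 S2 [L1 H1] [L2 H2]; exists (L1 ++ L2) => L sL; split.
      by apply: H1 => x xL; apply: sL; rewrite mem_cat xL.
    by apply: H2 => x xL; apply: sL; rewrite mem_cat xL orbT.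
  by move=> S1 S2 S12 [L1 H1]; exists L1 => L /H1; exact: S12.
have [|L0 /(_ L0)] := cK _ F (fun L x => exists2 p, p \in L & V p x) FF.
  move=> x Kx; exists (V x, [set L : seq T | x \in L]).
    by split; [exact: KV|exists [:: x] => L; apply; rewrite mem_head].
  by move=> [y L] [/= Vy xL]; exists x.
by move=> H; exists L0 => x Kx; apply: H.
Qed.

(** * Chart patches, plots from curves, and the second inclusion *)

Section local_data.
Context {R : realType} {m n : nat} {M : manifold R m} {N : manifold R n}.
Implicit Types f g : smooth_map M N.

Lemma smooth_map_ext f g : f =1 g -> f = g.
Proof.
case: f g => [f fP] [g gP] /= /funext fg.
by case: _ / fg gP => gP; congr SmoothMap; exact: Prop_irrelevance.
Qed.

(** The ball is closed because its image has to be the compact set of a subbasic weak neighbourhood;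
    its radius [3 * D.2] is the one that the gluing works with. *)
Definition chart_patch f (x : M) (D : chart R M m * chart R N n * R) :=
  [/\ atlas D.1.1, atlas D.1.2, chart_dom D.1.1 x, 0 < D.2 &
      forall y, `|y - D.1.1 x| <= 3 * D.2 ->
        (D.1.1 @` chart_dom D.1.1) y /\ chart_dom D.1.2 (f (chart_inv D.1.1 y))].

Lemma smooth_map_chart_open f (c : chart R M m) (d : chart R N n) :
  open (c @` (chart_dom c `&` setT `&` f @^-1` chart_dom d)).
Proof. exact: (@smooth_in_charts_open _ _ _ _ _ _ _ f _ c d openT (smooth_mapP f)). Qed.

Lemma chart_patch_exists f x : exists D, chart_patch f x D.
Proof.
have [c cM cx] := atlas_cover x; have [d dN dfx] := atlas_cover (f x).
have := open_nbhs_nbhs (conj (@smooth_map_chart_open f c d)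
  (ex_intro2 _ _ x (conj (conj cx I) dfx) erefl)).
move=> /nbhs_ballP[e /= e0 eP]; exists (c, d, e / 4); split=> //=; first by rewrite divr_gt0.
move=> y yx; have [|z [[cz _] dz] <-] := eP y.
  by rewrite -ball_normE /ball_/= distrC (le_lt_trans yx)//; lra.
by rewrite chart_funK//; split=> //; exists z.
Qed.

Lemma smooth_map_in_charts g (c : chart R M m) (d : chart R N n) (W : set 'rV[R]_m) :
  atlas c -> atlas d ->
  (forall y, W y -> (c @` chart_dom c) y /\ chart_dom d (g (chart_inv c y))) ->
  smooth_on W (d \o g \o chart_inv c).
Proof.
move=> cM dN Wcd; apply: smooth_on_subset ((smooth_mapP g).2 c d cM dN) => y /Wcd[[x cx <-]].
by rewrite chart_funK// => dx; exists x.
Qed.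

Lemma represented_at_snd f (z : 'rV[R]_1 * M) :
  represented_at (@euclidean_product_atlas R m M 1) (@atlas R n N) (fun z => f z.2) z.
Proof.
have [c cM cz] := atlas_cover z.2; have [d dN dz] := atlas_cover (f z.2).
pose O := c @` (chart_dom c `&` setT `&` f @^-1` chart_dom d).
have oO : open O := @smooth_map_chart_open f c d.
have sO : smooth_on O (d \o f \o chart_inv c) := (smooth_mapP f).2 c d cM dN.
have oO' : open [set w : 'rV[R]_(1 + m) | O (rsubmx w)].
  by apply: open_comp => // w _; exact: rsubmx_continuous.
exists (product_chart (euclidean_chart R 1) c), d, [set w | O (rsubmx w)],
  (d \o f \o chart_inv c \o rsubmx); split=> //.
- by split=> //; exists c.
- by split=> //=; rewrite row_mxKr; exists z.2.
- apply: (@smooth_on_comp _ _ _ _ _ O (@rsubmx R 1 1 m) (d \o f \o chart_inv c));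
    [exact: oO'|exact: oO|by []|exact: rsubmx_smooth|exact: sO].
- move=> w [x [[cx _] dx] xw]; split=> /=.
  + by exists (lsubmx w, x) => //=; rewrite xw hsubmxK.
  + by rewrite -xw chart_funK.
  + by [].
Qed.

Lemma curve_on_subset f (g : nat -> smooth_map M N) (X X' : set M) F U : X' `<=` X ->
  curve_on f g X F U -> curve_on f g X' F U.
Proof. by move=> X'X [H1 H2 H3 H4]; split=> // k x /X'X; exact: H4. Qed.

Lemma plot_of_curve f (g : nat -> smooth_map M N) F U : curve_on f g setT F U ->
  exists p : 'rV[R]_1 -> smooth_map M N,
    [/\ is_plot U p, p 0 = f & forall k, U (const_mx (time k)) -> p (const_mx (time k)) = g k].
Proof.
move=> [[oU U0] Frep F0 Ftime].
have /choice[p pE] : forall t, exists h : smooth_map M N, U t -> forall x, h x = F (t, x).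
  (* Outside [U] a slice of [F] may fail to be smooth, and [f] is a default value. *)
  move=> t; have [Ut|nUt] := pselect (U t); last by exists f.
  have Ft : smooth_in_charts (@atlas R m M) (@atlas R n N) setT (fun x => F (t, x)).
    apply: represented_smooth_in_charts; [exact: atlas_compatible|exact: atlas_compatible|].
    by move=> x _; apply: represented_at_slice; exact: Frep.
  by exists (SmoothMap Ft).
exists p; split.
- apply: represented_smooth_in_charts.
  + exact: euclidean_product_atlas_compatible.
  + exact: atlas_compatible.
  move=> z [Uz _]; apply: (@represented_at_eq _ _ _ _ _ _ _ F _ _ (U `*` setT)).
  + rewrite openE => w [Uw _]; exists (U, setT) => //=.
    by split; [exact: open_nbhs_nbhs|exact: filterT].
  + by [].
  + by move=> [t x] [/= Ut _]; rewrite pE.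
  + exact: Frep.
- by apply: smooth_map_ext => x; rewrite pE.
- by move=> k Uk; apply: smooth_map_ext => x; rewrite pE// Ftime.
Qed.

Lemma time_cvg0 (U : set 'rV[R]_1) : nbhs (0 : 'rV[R]_1) U -> exists k, U (const_mx (time k)).
Proof.
move=> /nbhs_ballP[e /= e0 eU].
have [k ek] : exists k : nat, 1 / e < k%:R.
  by exists (Num.bound (1 / e)); apply: archi_boundP; rewrite divr_ge0// ltW.
exists k; apply: eU; rewrite -ball_normE /ball_/= sub0r normrN.
apply: norm_row_lt => // i; rewrite mxE gtr0_norm ?time_gt0//.
have -> : e = (2 * e) / 2 by field.
apply: time_lt; first by rewrite mulr_gt0.
by rewrite invfM mulrA divff// in ek *.
Qed.

(* The first hypothesis is what [special_curve] says of its sequence eps, which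
   has to be chosen before the g k. *)
Lemma curve_on_patch f (g : nat -> smooth_map M N) (eps : nat -> R) X F U p D :
  (forall q (O : set 'rV[R]_m) (h : nat -> 'rV[R]_m -> 'rV[R]_q), open O ->
    (forall k, smooth_on O (h k)) ->
    (forall k s x, (size s <= k)%N -> O x -> `|iter_partial s (h k) x| <= eps k) ->
    exists G : 'rV[R]_(1 + m) -> 'rV[R]_q,
    [/\ smooth_on [set z | O (rsubmx z)] G,
        forall k x, G (row_mx (const_mx (time k)) x) = h k x &
        forall x, G (row_mx 0 x) = 0]) ->
  chart_patch f p D ->
  (forall k, weak_nbhd k f D.1.1 D.1.2
     (chart_inv D.1.1 @` [set y | `|y - D.1.1 p| <= 3 * D.2]) (eps k) (g k)) ->
  curve_on f g X F U -> exists F' U',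
    curve_on f g (X `|` [set x | chart_dom D.1.1 x /\ `|D.1.1 x - D.1.1 p| < D.2]) F' U'.
Proof.
case: D => [[c d] r] curve [/= cM dN cp r0 fcd] gW FU.
set a := c p in fcd gW *; pose O := [set y | `|y - a| < 3 * r].
have oO : open O.
  apply: (@open_comp _ _ (fun y : 'rV[R]_m => `|y - a|) [set x | x < 3 * r]); last exact: open_lt.
  by move=> y _; apply: (@norm_sub_continuous _ _ _ id) => z; exact: cvg_id.
have cO y : O y -> (c @` chart_dom c) y by move=> /ltW/fcd[].
have fO y : O y -> chart_dom d (f (chart_inv c y)) by move=> /ltW/fcd[].
have gO k y : O y -> chart_dom d (g k (chart_inv c y)).
  by move=> /ltW ya; apply: (gW k).1; exists (chart_inv c y) => //; exists y.
have sf : smooth_on O (d \o f \o chart_inv c).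
  by apply: smooth_map_in_charts => // y Oy; split; [exact: cO|exact: fO].
have sg k : smooth_on O (d \o g k \o chart_inv c).
  by apply: smooth_map_in_charts => // y Oy; split; [exact: cO|exact: gO].
pose h k y := (d \o g k \o chart_inv c) y - (d \o f \o chart_inv c) y.
have [||G [sG Gtime G0]] := curve n O h oO.
- by move=> k; exact: (smooth_onB oO (sg k) sf).
- move=> k s y sk Oy.
  rewrite (iter_partialB _ oO (sg k) sf Oy).
  rewrite (iter_partial_multi _ oO (sg k) Oy) (iter_partial_multi _ oO sf Oy) distrC.
  apply/ltW/(gW k).2; last by rewrite -size_multi_index -(perm_size (perm_multi_index s)).
  exists (chart_inv c y); first by exists y => //; exact: ltW.
  by rewrite chart_invK//; exact: cO.
have oW : open [set w : 'rV[R]_(1 + m) | O (rsubmx w)].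
  by apply: open_comp => // w _; exact: rsubmx_continuous.
apply: (@curve_on_extend _ _ _ _ _ f g c d a r cM dN r0 cO fO gO
  (fun w => (d \o f \o chart_inv c) (rsubmx w) + G w) _ _ _ X F U FU).
- apply: (smooth_onD oW _ sG).
  apply: (@smooth_on_comp _ _ _ _ _ O (@rsubmx R 1 1 m) (d \o f \o chart_inv c));
    [exact: oW|exact: oO|by []|exact: rsubmx_smooth|exact: sf].
- by move=> y _; rewrite row_mxKr G0 addr0.
- by move=> k y _; rewrite row_mxKr Gtime /h addrC subrK.
Qed.

Lemma weak_nbhd_self r f (c : chart R M m) (d : chart R N n) (K : set M) (e : R) :
  0 < e -> f @` K `<=` chart_dom d -> weak_nbhd r f c d K e f.
Proof. by move=> e0 fK; split=> // x _ i _; rewrite subrr normr0. Qed.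

Lemma D_sub_weak : compact [set: M] ->
  smooth_map_D_topology M N `<=` smooth_map_weak_topology M N.
Proof.
move=> cM A DA; rewrite /smooth_map_weak_topology openE => f Af.
apply: contrapT => nA.
have [D DP] := choice (chart_patch_exists f).
have [eps [eps0 curve]] := special_curve R.
pose core p := [set x | chart_dom (D p).1.1 x /\ `|(D p).1.1 x - (D p).1.1 p| < (D p).2].
have core_open p : open (core p).
  have [_ _ _ _ _] := DP p.
  have := @open_setI_preimage _ _ _ [set v : R | v < (D p).2]
    (fun x => `|(D p).1.1 x - (D p).1.1 p|) (chart_dom_open (D p).1.1).
  apply; first exact: open_lt.
  move=> x cx; apply: (@continuous_comp _ _ _ (D p).1.1 (fun v => `|v - (D p).1.1 p|)).
    exact: chart_fun_continuous.
  by apply: (@norm_sub_continuous _ _ _ id) => z; exact: cvg_id.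
have [L Lcover] : exists L : seq M, forall x, [set: M] x -> exists2 p, p \in L & core p x.
  apply: compact_finite_cover => // x _; apply: open_nbhs_nbhs; split=> //.
  by have [_ _ cx r0 _] := DP x; split=> //; rewrite subrr normr0.
pose K p := chart_inv (D p).1.1 @` [set y | `|y - (D p).1.1 p| <= 3 * (D p).2].
(* The index [k] is both the order and the rank of the accuracy, to match the condition
   [size s <= k] of [special_curve]. *)
pose S k p := weak_nbhd k f (D p).1.1 (D p).1.2 (K p) (eps k).
have Snbhs k p : nbhs (f : weak_smooth_map M N) (S k p).
  have [c1 d1 cp r0 fcd] := DP p.
  have fK : f @` K p `<=` chart_dom (D p).1.2.
    by move=> _ [_ [y /= yK <-] <-]; have [] := fcd y yK.
  apply: open_nbhs_nbhs; split; last exact: weak_nbhd_self.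
  apply: weak_subbasis_open; exists k, f, (D p).1.1, (D p).1.2, (K p), (eps k); split=> //.
  split; first by move=> _ [y /= yK <-]; apply: chart_inv_dom; have [] := fcd y yK.
  apply: continuous_compact; last exact: closed_ball_compact.
  apply: continuous_in_subspaceT => y /set_mem yK.
  by apply: chart_inv_continuous; have [] := fcd y yK.
have Sall k (s : seq M) : nbhs (f : weak_smooth_map M N) (fun g => forall p, p \in s -> S k p g).
  elim: s => [|p s IH]; first by apply: filterE.
  apply: filterS (filterI (Snbhs k p) IH) => h [/= Sp Ss] q.
  by rewrite inE => /predU1P[->//|]; exact: Ss.
(* [L] is finite, so the conditions over all its patches define one weak neighbourhood of [f]; it is
   not contained in [A], which leaves room for [g k]. *)
have /choice[g gP] : forall k, exists g : smooth_map M N,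
    (forall p, p \in L -> S k p g) /\ ~ A g.
  move=> k; apply: contrapT => /forallNP H; apply: nA.
  apply: filterS (Sall k L) => h Sh; apply: contrapT => nAh.
  by apply: (H h).
have steps (s : seq M) : {subset s <= L} -> exists F U,
    curve_on f g (fun x => exists2 p, p \in s & core p x) F U.
  elim: s => [_|p s IH sL].
    (* The constant curve at [f], with no point yet where the values [g k] are prescribed. *)
    exists (fun z => f z.2), setT; split=> //; first by split=> //; exact: openT.
      by move=> z _; exact: represented_at_snd.
    by move=> k x [].
  have [|F [U FU]] := IH; first by move=> q qs; apply: sL; rewrite inE qs orbT.
  have pL : p \in L by apply: sL; rewrite mem_head.
  have [F' [U' FU']] := curve_on_patch (curve m) (DP p) (fun k => (gP k).1 p pL) FU.
  exists F', U'; apply: curve_on_subset FU' => x [q].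
  by rewrite inE => /predU1P[->|qs] cqx; [right|left; exists q].
have [F [U FU]] := steps L (fun p pL => pL).
have {}FU : curve_on f g setT F U.
  by apply: curve_on_subset FU => x /Lcover[p pL cpx]; exists p.
have [p [pU p0 ptime]] := plot_of_curve FU.
have [[oU U0] _ _ _] := FU.
have oUA := DA 1%N U p oU pU.
have [|k [Uk Ak]] := @time_cvg0 (U `&` p @^-1` A).
  by apply: open_nbhs_nbhs; split=> //; split=> //; rewrite /preimage /= p0.
by apply: (gP k).2; rewrite -ptime.
Qed.

End local_data.

Theorem corollary4p14 (R : realType) (m n : nat)
    (M : manifold R m) (N : manifold R n) (compactM : compact [set: M]) :
  smooth_map_D_topology M N = smooth_map_weak_topology M N.
Proof. by apply/seteqP; split; [exact: D_sub_weak|exact: weak_sub_D]. Qed.
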